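(* Let $\boldsymbol{P}$ be an M/G/1-type transition probability matrix (block form given in the context) with blocks $\{\boldsymbol{A}(k);k\ge -1\}$, $\{\boldsymbol{B}(k);k\ge -1\}$, and suppose that: (i) the stochastic matrix $\boldsymbol{P}$ is irreducible; (ii) $\boldsymbol{A}:=\sum_{k=-1}^\infty \boldsymbol{A}(k)$ is an irreducible stochastic matrix, with unique stationary distribution vector $\boldsymbol{\varpi}$; (iii) $\overline{\boldsymbol{m}}_B:=\sum_{k=1}^\infty k\boldsymbol{B}(k)\boldsymbol{e}<\infty$ (entrywise); (iv) $\sigma:=\boldsymbol{\varpi}\,\overline{\boldsymbol{m}}_A<0$, where $\overline{\boldsymbol{m}}_A=\sum_{k=-1}^\infty k\boldsymbol{A}(k)\boldsymbol{e}$. Suppose further that there exists a distribution function $F$ on $\mathbb{Z}_+$ that is long-tailed and satisfies $$\lim_{N\to\infty}\frac{\overline{\overline{\boldsymbol{A}}}(N)\boldsymbol{e}}{\overline{F}(N)}=\boldsymbol{c}_A,\qquad \lim_{N\to\infty}\frac{\overline{\overline{\boldsymbol{B}}}(N)\boldsymbol{e}}{\overline{F}(N)}=\boldsymbol{c}_B,$$ where $\boldsymbol{c}_A\ge\boldsymbol{0}$ and $\boldsymbol{c}_B\ge\boldsymbol{0}$ are $M_1$- and $M_0$-dimensional finite column vectors, respectively, and either of them is a non-zero vector. Let $\boldsymbol{\pi}=(\boldsymbol{\pi}(0),\boldsymbol{\pi}(1),\dots)$ be the unique stationary distribution vector of $\boldsymbol{P}$ and let $\boldsymbol{\pi}^{(N)}=(\boldsymbol{\pi}^{(N)}(0),\boldsymbol{\pi}^{(N)}(1),\dots)$,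 $N\in\mathbb{N}$, be the unique stationary distribution vector of the level-increment truncation approximation $\boldsymbol{P}^{(N)}$. Then, for every $k\in\mathbb{Z}_+$, $$\lim_{N\to\infty}\frac{\boldsymbol{\pi}^{(N)}(k)-\boldsymbol{\pi}(k)}{\overline{F}(N)}=\frac{\boldsymbol{\pi}(0)\boldsymbol{c}_B+\overline{\boldsymbol{\pi}}(0)\boldsymbol{c}_A}{-\sigma}\,\boldsymbol{\pi}(k)>\boldsymbol{0},$$ and thus, for every $k\in\mathbb{Z}_+$, $$\lim_{N\to\infty}\frac{1}{\overline{F}(N)}\left\|\frac{\boldsymbol{\pi}^{(N)}(k)-\boldsymbol{\pi}(k)}{\boldsymbol{\pi}(k)\boldsymbol{e}}\right\|=\frac{\boldsymbol{\pi}(0)\boldsymbol{c}_B+\overline{\boldsymbol{\pi}}(0)\boldsymbol{c}_A}{-\sigma}>0,$$ where $\overline{\boldsymbol{\pi}}(k)=\sum_{\ell=k+1}^\infty\boldsymbol{\pi}(\ell)$ for $k\in\mathbb{Z}_+$.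
   Context: Notation. $\mathbb{Z}_+=\{0,1,2,\dots\}$, $\mathbb{N}=\{1,2,\dots\}$. $\boldsymbol{e}$ is the column vector of ones, $\boldsymbol{0}$ a zero vector, $\boldsymbol{O}$ a zero matrix (of appropriate sizes). Vector inequalities, limits and finiteness are entrywise. For a row vector $\boldsymbol{x}$, $\|\boldsymbol{x}\|=|\boldsymbol{x}|\boldsymbol{e}$ (total variation norm) is the sum of the absolute values of its entries. M/G/1-type matrix. Fix $M_0,M_1\in\mathbb{N}$, $\mathbb{M}_0=\{1,\dots,M_0\}$, $\mathbb{M}_1=\{1,\dots,M_1\}$. The state space is $\mathbb{S}=\bigcup_{k=0}^\infty\{k\}\times\mathbb{M}_{\min(k,1)}$; level $k$ is $\mathbb{L}_k=\{k\}\times\mathbb{M}_{\min(k,1)}$. $\boldsymbol{P}$ is a stochastic matrix on $\mathbb{S}$ whose blocks (rows from $\mathbb{L}_k$, columns to $\mathbb{L}_\ell$) are: $(0,\ell)$-block $\boldsymbol{B}(\ell)$ for $\ell\ge0$; $(1,0)$-block $\boldsymbol{B}(-1)$; $(k,\ell)$-block $\boldsymbol{A}(\ell-k)$ for $k\ge1$, $\ell\ge 1$, $\ell\ge k-1$; all other blocks are $\boldsymbol{O}$. All blocks are nonnegative; $\boldsymbol{A}(k)$ is $M_1\times M_1$, $\boldsymbol{B}(0)$ is $M_0\times M_0$, $\boldsymbol{B}(-1)$ is $M_1\times M_0$, and $\boldsymbol{B}(k)$ is $M_0\times M_1$ for $k\ge1$. Under (i)--(iv), $\boldsymbol{P}$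 is irreducible and positive recurrent, so it has a unique stationary distribution vector $\boldsymbol{\pi}$, partitioned by levels as $(\boldsymbol{\pi}(0),\boldsymbol{\pi}(1),\dots)$. Tail matrices. $\overline{\boldsymbol{A}}(k)=\sum_{\ell=k+1}^\infty\boldsymbol{A}(\ell)$, $\overline{\boldsymbol{B}}(k)=\sum_{\ell=k+1}^\infty\boldsymbol{B}(\ell)$, $\overline{\overline{\boldsymbol{A}}}(k)=\sum_{\ell=k+1}^\infty\overline{\boldsymbol{A}}(\ell)$, $\overline{\overline{\boldsymbol{B}}}(k)=\sum_{\ell=k+1}^\infty\overline{\boldsymbol{B}}(\ell)$ (for $k\ge 0$). Level-increment (LI) truncation. For $N\in\mathbb{N}$, $\boldsymbol{P}^{(N)}$ is the M/G/1-type stochastic matrix with the same block layout as $\boldsymbol{P}$ but with $\boldsymbol{A}(k),\boldsymbol{B}(k)$ replaced by $\boldsymbol{A}^{(N)}(k),\boldsymbol{B}^{(N)}(k)$, where $\boldsymbol{A}^{(N)}(k)=\boldsymbol{A}(k)$ for $-1\le k\le N-1$, $\boldsymbol{A}^{(N)}(N)=\overline{\boldsymbol{A}}(N-1)$, $\boldsymbol{A}^{(N)}(k)=\boldsymbol{O}$ for $k\ge N+1$, and likewise $\boldsymbol{B}^{(N)}(k)=\boldsymbol{B}(k)$ for $-1\le k\le N-1$, $\boldsymbol{B}^{(N)}(N)=\overline{\boldsymbol{B}}(N-1)$, $\boldsymbol{B}^{(N)}(k)=\boldsymbol{O}$ for $k\ge N+1$. Under (i)--(iv), for any $N\in\mathbb{N}$,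 $\boldsymbol{P}^{(N)}$ is positive Harris recurrent with Harris recurrent set $\mathbb{L}_0$, and $\boldsymbol{\pi}^{(N)}$ denotes the unique stationary distribution vector of $\boldsymbol{P}^{(N)}$, partitioned by levels. Long-tailed. $\overline{F}=1-F$. A distribution function $F$ on $\mathbb{Z}_+$ is long-tailed if $\overline{F}(k)>0$ for all $k\in\mathbb{Z}_+$ and $\lim_{k\to\infty}\overline{F}(k+n)/\overline{F}(k)=1$ for every $n\in\mathbb{Z}_+$. *)

(* Defs.v *)
From HB Require Import structures.
From mathcomp Require Import all_boot all_order all_algebra.
From mathcomp Require Import all_classical all_reals all_analysis.

Set Implicit Arguments.
Unset Strict Implicit.
Unset Printing Implicit Defensive.

Import Order.TTheory GRing.Theory Num.Theory numFieldNormedType.Exports.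

Local Open Scope classical_set_scope.
Local Open Scope ring_scope.

(* Nonnegative matrices indexed by a (finite or countable) state space. *)

Definition stochastic (R : realType) (T : choiceType) (P : T -> T -> R) : Prop :=
  (forall x y, 0 <= P x y) /\
  (forall x, (\esum_(y in [set: T]) (P x y)%:E)%R = 1%E).

(* The entries of the n-th power of P. *)
Fixpoint nstep (R : realType) (T : choiceType) (P : T -> T -> R) (n : nat)
    (x y : T) : \bar R :=
  if n is n'.+1 then (\esum_(z in [set: T]) ((P x z)%:E * nstep P n' z y)%E)%R
  else ((x == y)%:R)%:E.

Definition irreducible (R : realType) (T : choiceType) (P : T -> T -> R) : Prop :=
  forall x y, exists n : nat, (0 < nstep P n x y)%E.

Definition stationary_distribution (R : realType) (T : choiceType)
    (P : T -> T -> R) (mu : T -> R) : Prop :=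
  [/\ forall x, 0 <= mu x,
      (\esum_(x in [set: T]) (mu x)%:E)%R = 1%E
    & forall y, (\esum_(x in [set: T]) (mu x * P x y)%:E)%R = (mu y)%:E].

Definition ones (R : realType) (n : nat) : 'cV[R]_n := const_mx 1.

(* Entrywise limit; this is the coordinatewise topology in any dimension. *)
Definition mx_cvg (R : realType) (m n : nat) (f : nat -> 'M[R]_(m, n))
    (L : 'M[R]_(m, n)) : Prop :=
  forall i j, (fun N => f N i j) @ \oo --> L i j.

(* Entrywise sum of a series; it is meaningful only when every entry
   converges, since [limn] of a divergent sequence is arbitrary.  *)
Definition mx_series (R : realType) (m n : nat) (f : nat -> 'M[R]_(m, n)) :
    'M[R]_(m, n) :=
  \matrix_(i, j) limn (series (fun l => f l i j)).

Definition tvnorm (R : realType) (n : nat) (x : 'rV[R]_n) : R :=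
  \sum_j `|x ord0 j|.

(* Size of level k. *)
Definition lev (M0 M1 k : nat) : nat := if k is 0 then M0 else M1.

Definition mg1_state (M0 M1 : nat) := {k : nat & 'I_(lev M0 M1 k)}.

(* [blkA k] is meaningful for k >= -1 only; the values at k < -1 are never
   used.  [blkBm1] is the block B(-1). *)
Record mg1_blocks (R : realType) (M0 M1 : nat) := MG1Blocks {
  blkA : int -> 'M[R]_M1;
  blkBm1 : 'M[R]_(M1, M0);
  blkB : forall k : nat, 'M[R]_(M0, lev M0 M1 k)
}.

Definition mg1_block (R : realType) (M0 M1 : nat) (X : mg1_blocks R M0 M1)
    (k l : nat) : 'M[R]_(lev M0 M1 k, lev M0 M1 l) :=
  match k, l return 'M[R]_(lev M0 M1 k, lev M0 M1 l) with
  | 0, l => blkB X l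
  | 1, 0 => blkBm1 X
  | _.+2, 0 => 0
  | k'.+1, l'.+1 =>
      if (k'.+1 <= l'.+2)%N then blkA X (l'.+1%:Z - k'.+1%:Z) else 0
  end.

Definition mg1_mx (R : realType) (M0 M1 : nat) (X : mg1_blocks R M0 M1)
    (x y : mg1_state M0 M1) : R :=
  mg1_block X (tag x) (tag y) (tagged x) (tagged y).

(* Sub-vector of mu on level k. *)
Definition level_part (R : realType) (M0 M1 : nat) (mu : mg1_state M0 M1 -> R)
    (k : nat) : 'rV[R]_(lev M0 M1 k) :=
  \row_i mu (existT (fun k => 'I_(lev M0 M1 k)) k i).

(* Sum of the sub-vectors of mu on the levels > k. *)
Definition level_tail (R : realType) (M0 M1 : nat) (mu : mg1_state M0 M1 -> R)
    (k : nat) : 'rV[R]_M1 :=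
  mx_series (fun l => level_part mu (k + l).+1).

Definition mx_tail (R : realType) (m n : nat) (f : nat -> 'M[R]_(m, n))
    (k : nat) : 'M[R]_(m, n) :=
  mx_series (fun l => f (k + l).+1).

Definition tailA (R : realType) (M0 M1 : nat) (X : mg1_blocks R M0 M1)
    (k : nat) : 'M[R]_M1 :=
  mx_tail (fun l => blkA X l%:Z) k.

Definition tailB (R : realType) (M0 M1 : nat) (X : mg1_blocks R M0 M1)
    (k : nat) : 'M[R]_(M0, M1) :=
  mx_series (fun l => blkB X (k + l).+1).

Definition tail2A (R : realType) (M0 M1 : nat) (X : mg1_blocks R M0 M1)
    (k : nat) : 'M[R]_M1 :=
  mx_tail (tailA X) k.

Definition tail2B (R : realType) (M0 M1 : nat) (X : mg1_blocks R M0 M1)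
    (k : nat) : 'M[R]_(M0, M1) :=
  mx_tail (tailB X) k.

(* A = A(-1) + A(0) + A(1) + ..., with the index shifted by one. *)
Definition sumA (R : realType) (M0 M1 : nat) (X : mg1_blocks R M0 M1) : 'M[R]_M1 :=
  mx_series (fun j => blkA X (j%:Z - 1)).

(* The mean increments are extended reals, since their finiteness is an
   assumption ([meanB]) or a consequence of the negative drift ([meanA]). *)
Definition meanA (R : realType) (M0 M1 : nat) (X : mg1_blocks R M0 M1)
    (i : 'I_M1) : \bar R :=
  (\sum_(0 <= j <oo)
     ((j%:R - 1) * (blkA X (j%:Z - 1) *m ones R M1) i ord0)%:E)%E.

Definition meanB (R : realType) (M0 M1 : nat) (X : mg1_blocks R M0 M1)
    (i : 'I_M0) : \bar R :=
  (\sum_(1 <= k <oo) (k%:R * (blkB X k *m ones R _) i ord0)%:E)%E.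

Definition drift (R : realType) (M0 M1 : nat) (X : mg1_blocks R M0 M1)
    (varpi : 'rV[R]_M1) : \bar R :=
  (\sum_(i < M1) (varpi ord0 i)%:E * meanA X i)%E.

(* Level-increment truncation, for N >= 1 (so B(-1) and B(0) are kept). *)
Definition LI_trunc (R : realType) (M0 M1 : nat) (X : mg1_blocks R M0 M1)
    (N : nat) : mg1_blocks R M0 M1 :=
  {| blkA := fun k : int =>
       if k < N%:Z then blkA X k
       else if k == N%:Z then tailA X N.-1 else 0;
     blkBm1 := blkBm1 X;
     blkB := fun k : nat =>
       match k return 'M[R]_(M0, lev M0 M1 k) with
       | 0 => blkB X 0%N
       | k'.+1 => if (k'.+1 < N)%N then blkB X k'.+1
                  else if k'.+1 == N then tailB X N.-1 else 0
       end |}.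

Definition distribution_function (R : realType) (F : nat -> R) : Prop :=
  [/\ 0 <= F 0%N, {homo F : m n / (m <= n)%N >-> m <= n} & F @ \oo --> (1 : R)].

Definition tailF (R : realType) (F : nat -> R) (k : nat) : R := 1 - F k.

Definition long_tailed (R : realType) (F : nat -> R) : Prop :=
  (forall k, 0 < tailF F k) /\
  (forall n : nat, (fun k => tailF F (k + n)%N / tailF F k) @ \oo --> (1 : R)).

(* (pi(0) c_B + \bar{pi}(0) c_A) / (- sigma); [fine] is harmless because sigma is
   finite whenever it is negative. *)
Definition decay_const (R : realType) (M0 M1 : nat) (X : mg1_blocks R M0 M1)
    (varpi : 'rV[R]_M1) (cA : 'cV[R]_M1) (cB : 'cV[R]_M0)
    (pi : mg1_state M0 M1 -> R) : R :=
  ((level_part pi 0%N *m cB) ord0 ord0 + (level_tail pi 0%N *m cA) ord0 ord0)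
    / - fine (drift X varpi).

(* Main.v *)
Require Import Defs.
From mathcomp Require Import all_boot all_order all_algebra.
From mathcomp Require Import all_classical all_reals all_analysis.
From mathcomp Require Import finmap zify ring lra.
Import Order.TTheory GRing.Theory Num.Theory numFieldNormedType.Exports.
Local Open Scope classical_set_scope.
Local Open Scope ring_scope.

(* Let [P_N] be the truncation and [a] a fixed state of level 0.  For every
   state [y] the Poisson equation [(I - P) w = 1_y - (pi y / pi a) 1_a] has a
   bounded solution, and testing it against [pi_N] gives
   [pi_N y = rho_N * pi y + o(1 - F(N))] with [rho_N = pi_N a / pi a], because
   the rows of [P_N - P] have mass of the order of the simple tails, which is
   [o(1 - F(N))] by long-tailedness.  It remains to find the asymptotics of
   [rho_N - 1].  Correcting the level by a solution [b] of the Poisson equation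
   of the finite chain [A] yields a function [V(k, i) = k + b_i] with
   [P V = V + sigma] on the levels [k >= 2].  The truncation moves every level
   down by its overshoot over [k + N], so [P V - P_N V] is exactly the double
   tail [tail2A (N - 1) e] or [tail2B (N - 1) e].  Comparing the two identities
   [pi (P V - V) = 0] and [pi_N (P_N V - V) = 0], in which only the finitely
   many states of levels 0 and 1 contribute apart from the constant [sigma],
   gives [- sigma (rho_N - 1)] = [pi_N] applied to the double tails, up to
   [o(1 - F(N))]. *)

Set Implicit Arguments.
Unset Strict Implicit.
Unset Printing Implicit Defensive.

(** * Sums of real families over a type *)

(** Convergence of [pi_N] to [pi] is not given in advance; it comes out of the identity that also
    yields the rate. That identity is exact for every [N], and its right-hand side stays bounded
    because the double tails divided by [1 - F(N)] are bounded uniformly in the state. Multiplying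
    by [1 - F(N)] gives [rho_N -> 1], hence pointwise convergence of [pi_N], and only then can the
    limit of [pi_N] applied to the double tails be taken. Irreducibility of [P_N] is not among the
    assumptions, so Poisson equations are solved for [P] alone, and [pi_N] enters through its
    stationarity. No second moment of the increments is assumed, so [V] may have infinite mean under
    [pi]; for this reason the identities concern the mean of the drift and not a difference of two
    means of [V]. *)

Lemma addr_norm_ge0 {R : realDomainType} (x : R) : 0 <= `|x| + x.
Proof. by rewrite -lerBlDr sub0r -normrN ler_norm. Qed.

Section RealSums.
Context {R : realType} {T : choiceType}.
Implicit Types f g h : T -> R.

Definition rsummable f : Prop := summable [set: T] (EFin \o f).

(** Both families are nonnegative, as [\esum] requires; taking [|f| + f] instead of the positive
    part keeps pointwise identities linear. The value is meant for summable [f], since [fine] sends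
    an infinite sum to 0. *)
Definition rsum f : R :=
  fine (\esum_(x in [set: T]) (`|f x| + f x)%:E)
  - fine (\esum_(x in [set: T]) (`|f x|)%:E).

Lemma rsummable_le f g : (forall x, `|f x| <= g x) -> rsummable g -> rsummable f.
Proof.
move=> fg; apply: le_lt_trans; apply: le_esum => x _ /=.
by rewrite lee_fin (le_trans (fg x))// ler_norm.
Qed.

Lemma rsummable_esum f : (forall x, 0 <= f x) ->
  rsummable f <-> (\esum_(x in [set: T]) (f x)%:E < +oo)%E.
Proof.
move=> f0; suff -> : \esum_(x in [set: T]) (f x)%:E = \esum_(x in [set: T]) `|(f x)%:E|%E.
  by [].
by apply: eq_esum => x _ /=; rewrite ger0_norm.
Qed.

Lemma esum_fin f : (forall x, 0 <= f x) -> rsummable f ->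
  \esum_(x in [set: T]) (f x)%:E \is a fin_num.
Proof.
move=> f0 /(rsummable_esum f0) h; rewrite ge0_fin_numE//.
by apply: esum_ge0 => x _; rewrite lee_fin.
Qed.

Lemma rsummableD f g : rsummable f -> rsummable g -> rsummable (fun x => f x + g x).
Proof. exact: summableD. Qed.

Lemma rsummableN f : rsummable f -> rsummable (fun x => - f x).
Proof. by rewrite /rsummable summableN. Qed.

Lemma rsummableB f g : rsummable f -> rsummable g -> rsummable (fun x => f x - g x).
Proof. by move=> sf /rsummableN; exact: rsummableD. Qed.

Lemma rsummable_norm f : rsummable f -> rsummable (fun x => `|f x|).
Proof. by apply: le_lt_trans; apply: le_esum => x _ /=; rewrite normr_id. Qed.

Lemma rsummable0 : rsummable (fun=> 0).
Proof. by rewrite /rsummable /summable esum1 ?ltry// => x _ /=; rewrite normr0. Qed.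

Lemma rsummableMn f n : rsummable f -> rsummable (fun x => f x *+ n).
Proof.
move=> sf; elim: n => [|n IHn]; first exact: rsummable0.
by under eq_fun do rewrite mulrSr; exact: rsummableD.
Qed.

(** Additivity gives natural multiples, and one of these dominates [a * f]. *)
Lemma rsummableZ a f : rsummable f -> rsummable (fun x => a * f x).
Proof.
move=> /rsummable_norm sf.
apply: (@rsummable_le _ (fun x => `|f x| *+ (Num.truncn `|a|).+1)); last first.
  exact: rsummableMn.
move=> x; rewrite normrM -mulr_natl ler_wpM2r//.
by apply/ltW; rewrite truncnS_gt.
Qed.

(** The sum is independent of the decomposition: [(|f| + f) + h = |f| + g] holds pointwise between
    nonnegative terms, where [\esum] is additive. *)
Lemma rsum_diff g h f : (forall x, 0 <= g x) -> (forall x, 0 <= h x) ->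
  rsummable g -> rsummable h -> (forall x, f x = g x - h x) ->
  rsum f = fine (\esum_(x in [set: T]) (g x)%:E)
           - fine (\esum_(x in [set: T]) (h x)%:E).
Proof.
move=> g0 h0 sg sh fE.
have sf : rsummable f by rewrite (funext fE); exact: rsummableB.
have p0 x : 0 <= `|f x| + f x := addr_norm_ge0 _.
have sp : rsummable (fun x => `|f x| + f x).
  by apply: rsummableD => //; exact: rsummable_norm.
have sn := rsummable_norm sf.
have : \esum_(x in [set: T]) (`|f x| + f x)%:E + \esum_(x in [set: T]) (h x)%:E
   = (\esum_(x in [set: T]) (`|f x|)%:E + \esum_(x in [set: T]) (g x)%:E)%E.
  rewrite -!esumD; do ?by move=> x _; rewrite lee_fin.
  by apply: eq_esum => x _; rewrite -!EFinD fE; congr _%:E; lra.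
move=> /(congr1 fine); rewrite !fineD ?esum_fin//.
by rewrite /rsum; lra.
Qed.

Lemma rsum_fine f : (forall x, 0 <= f x) -> rsummable f ->
  rsum f = fine (\esum_(x in [set: T]) (f x)%:E).
Proof.
move=> f0 sf; rewrite (@rsum_diff f (fun=> 0))//; last 2 first.
- exact: rsummable0.
- by move=> x; rewrite subr0.
by rewrite [X in _ - fine X]esum1// subr0.
Qed.

Lemma rsumE f : (forall x, 0 <= f x) -> rsummable f ->
  \esum_(x in [set: T]) (f x)%:E = (rsum f)%:E.
Proof. by move=> f0 sf; rewrite rsum_fine// fineK// esum_fin. Qed.

Lemma rsumB f g : rsummable f -> rsummable g ->
  rsum (fun x => f x - g x) = rsum f - rsum g.
Proof.
move=> sf sg; have nf := rsummable_norm sf; have ng := rsummable_norm sg.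
have p0 k (x : T) : 0 <= `|k x| + k x :> R := addr_norm_ge0 _.
rewrite (@rsum_diff (fun x => (`|f x| + f x) + `|g x|) (fun x => `|f x| + (`|g x| + g x))); last 5 first.
- by move=> x; apply: addr_ge0.
- by move=> x; apply: addr_ge0.
- by apply: (rsummableD (rsummableD nf sf) ng).
- by apply: (rsummableD nf (rsummableD ng sg)).
- by move=> x; lra.
under eq_esum do rewrite EFinD.
under [X in _ - fine X]eq_esum do rewrite EFinD.
rewrite !esumD; do ?by move=> x _; rewrite lee_fin.
have pf := p0 f; have pg := p0 g.
have sf' := rsummableD nf sf; have sg' := rsummableD ng sg.
rewrite !fineD ?esum_fin//.
by rewrite /rsum; lra.
Qed.

Lemma rsum0 : rsum (fun=> 0) = 0.
Proof. by have := rsumB rsummable0 rsummable0; rewrite subr0 subrr. Qed.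

Lemma rsumN f : rsummable f -> rsum (fun x => - f x) = - rsum f.
Proof.
by move=> sf; under eq_fun do rewrite -sub0r; rewrite rsumB ?rsum0 ?sub0r//; exact: rsummable0.
Qed.

Lemma rsumD f g : rsummable f -> rsummable g ->
  rsum (fun x => f x + g x) = rsum f + rsum g.
Proof.
move=> sf sg; rewrite -[rsum g]opprK -rsumN// -rsumB//; last exact: rsummableN.
by under [in RHS]eq_fun do rewrite opprK.
Qed.

Lemma rsum_ge0 f : (forall x, 0 <= f x) -> 0 <= rsum f.
Proof.
move=> f0; have [sf|nsf] := pselect (rsummable f).
  by rewrite rsum_fine// fine_ge0// esum_ge0// => x _; rewrite lee_fin.
(* Without summability the subtracted sum is [+oo], whose [fine] is 0, and the nonnegative first
   term remains. *)
rewrite /rsum [X in _ - fine X](_ : _ = +oo%E)/= ?subr0.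
  by rewrite fine_ge0// esum_ge0// => x _; rewrite lee_fin addr_ge0.
apply/eqP; rewrite -leye_eq leNgt; apply/negP => h; apply: nsf.
exact: h.
Qed.

Lemma ler_rsum f g : rsummable f -> rsummable g -> (forall x, f x <= g x) ->
  rsum f <= rsum g.
Proof.
by move=> sf sg fg; rewrite -subr_ge0 -rsumB// rsum_ge0// => x; rewrite subr_ge0.
Qed.

Lemma rsum_norm f : rsummable f -> `|rsum f| <= rsum (fun x => `|f x|).
Proof.
move=> sf; have nf := rsummable_norm sf; rewrite ler_norml; apply/andP; split.
  rewrite -rsumN// ler_rsum//; first exact: rsummableN.
  by move=> x; have := ler_norm (- f x); rewrite normrN; lra.
by rewrite ler_rsum// => x; exact: ler_norm.
Qed.

Lemma rsum_ge_fin f (s : seq T) : uniq s -> (forall x, 0 <= f x) ->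
  rsummable f -> \sum_(x <- s) f x <= rsum f.
Proof.
move=> us f0 sf; rewrite -lee_fin -rsumE//.
apply: esum_ge; exists [set` s]; first by split=> //; exact: finite_seq.
by rewrite -fsbig_seq// -sumEFin.
Qed.

Lemma rsummable_bound f C :
  (forall s : seq T, uniq s -> \sum_(x <- s) `|f x| <= C) -> rsummable f.
Proof.
move=> h; rewrite /rsummable /summable; apply: (@le_lt_trans _ _ C%:E); last exact: ltry.
apply: ge_ereal_sup => _ [X [finX _] <-].
rewrite fsbig_finite//= sumEFin lee_fin; apply: h.
exact: fset_uniq.
Qed.

Lemma rsum_approx f (e : R) : (forall x, 0 <= f x) -> rsummable f -> 0 < e ->
  exists2 s : seq T, uniq s & rsum f <= \sum_(x <- s) f x + e.
Proof.
move=> f0 sf e0.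
have : ((rsum f - e)%:E < \esum_(x in [set: T]) (f x)%:E)%E.
  by rewrite rsumE// lte_fin; lra.
move=> /ereal_sup_gt[_ [X [finX _] <-]].
rewrite fsbig_finite//= sumEFin lte_fin => h.
exists (fset_set X); first exact: fset_uniq.
by lra.
Qed.

Lemma rsumZ_ge0 a f : 0 <= a -> (forall x, 0 <= f x) -> rsummable f ->
  rsum (fun x => a * f x) = a * rsum f.
Proof.
move=> a0 f0 sf; have saf := rsummableZ a sf.
have af0 x : 0 <= a * f x by rewrite mulr_ge0.
apply/eqP; rewrite eq_le; apply/andP; split; apply/ler_addgt0Pr => e e0.
- have [s us hs] := rsum_approx af0 saf e0.
  rewrite (le_trans hs)// lerD2r -mulr_sumr ler_wpM2l//.
  exact: rsum_ge_fin.
(* After multiplication by [a] this slack costs at most [e], also when [a = 0]. *)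
- have e0' : 0 < e / (a + 1) by rewrite divr_gt0// ltr_wpDl.
  have [s us hs] := rsum_approx f0 sf e0'.
  rewrite (le_trans (ler_wpM2l a0 hs))// mulrDr mulr_sumr lerD//.
    exact: rsum_ge_fin.
  rewrite mulrCA ler_piMr ?(ltW e0)// ler_pdivrMr ?mul1r; first by lra.
  by rewrite ltr_wpDl.
Qed.

Lemma rsumZ a f : rsummable f -> rsum (fun x => a * f x) = a * rsum f.
Proof.
wlog a0 : a / 0 <= a => [hw sf|sf].
  have [/hw->//|/ltW] := leP 0 a; rewrite -oppr_ge0 => /hw {}hw.
  have -> : (fun x => a * f x) = (fun x => - (- a * f x)).
    by apply/funext => x; rewrite mulNr opprK.
  by rewrite rsumN ?hw ?mulNr ?opprK//; exact: rsummableZ.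
have nf := rsummable_norm sf.
have p0 (x : T) : 0 <= `|f x| + f x := addr_norm_ge0 _.
have -> : (fun x => a * f x) = (fun x => a * (`|f x| + f x) - a * `|f x|).
  by apply/funext => x; lra.
rewrite rsumB; last 2 first.
- by apply: rsummableZ; exact: rsummableD.
- exact: rsummableZ.
rewrite !rsumZ_ge0//; last exact: rsummableD.
by rewrite rsumD//; lra.
Qed.

Lemma rsumZr a f : rsummable f -> rsum (fun x => f x * a) = rsum f * a.
Proof. by move=> sf; under eq_fun do rewrite mulrC; rewrite rsumZ// mulrC. Qed.

Lemma rsummableZr a f : rsummable f -> rsummable (fun x => f x * a).
Proof. by move=> sf; under eq_fun do rewrite mulrC; exact: rsummableZ. Qed.

Lemma rsum_fin f (s : seq T) : uniq s -> (forall x, x \notin s -> f x = 0) ->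
  rsummable f /\ rsum f = \sum_(x <- s) f x.
Proof.
move=> us f0.
have key g : (forall x, 0 <= g x) -> (forall x, x \notin s -> g x = 0) ->
    rsummable g /\ rsum g = \sum_(x <- s) g x.
  move=> g0 gs.
  have h (t : seq T) : uniq t -> \sum_(x <- t) `|g x| <= \sum_(x <- s) g x.
    move=> ut; under eq_bigr do rewrite ger0_norm//.
    rewrite (bigID (mem s))/= [X in _ + X]big1 ?addr0//.
    rewrite [leRHS](bigID (mem t))/= ler_wpDr//; first exact: sumr_ge0.
    rewrite le_eqVlt; apply/orP; left; apply/eqP.
    rewrite -big_filter -[RHS]big_filter; apply: perm_big.
    apply: uniq_perm; rewrite ?filter_uniq// => x.
    by rewrite !mem_filter andbC.
  have sg := rsummable_bound h; split=> //.
  apply/eqP; rewrite eq_le rsum_ge_fin// andbT.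
  apply/ler_addgt0Pr => e e0; have [t ut ht] := rsum_approx g0 sg e0.
  rewrite (le_trans ht)// lerD2r (le_trans _ (h t ut))// ler_sum// => x _.
  exact: ler_norm.
have p0 (x : T) : 0 <= `|f x| + f x := addr_norm_ge0 _.
have [|s1 e1] := key (fun x => `|f x| + f x) p0.
  by move=> x xs; rewrite f0// normr0 addr0.
have [||s2 e2] := key (fun x => `|f x|); first by move=> x.
  by move=> x xs; rewrite f0// normr0.
have fE : f = (fun x => (`|f x| + f x) - `|f x|) by apply/funext => x; lra.
split; first by rewrite fE; exact: rsummableB.
rewrite [in LHS]fE rsumB// e1 e2 -sumrB; apply: eq_bigr => x _; lra.
Qed.

Lemma rsum_if y f : rsummable (fun x => if x == y then f x else 0) /\
  rsum (fun x => if x == y then f x else 0) = f y.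
Proof.
have [//||sf ->] := @rsum_fin (fun x => if x == y then f x else 0) [:: y].
  by move=> x; rewrite inE => /negbTE ->.
by rewrite big_seq1 eqxx.
Qed.

Lemma rsummable_sum (I : Type) (r : seq I) (F : I -> T -> R) :
  (forall i, rsummable (F i)) -> rsummable (fun x => \sum_(i <- r) F i x).
Proof.
move=> sF; elim: r => [|i r IHr].
  by under eq_fun do rewrite big_nil; exact: rsummable0.
by under eq_fun do rewrite big_cons; exact: rsummableD.
Qed.

Lemma rsum_sum (I : Type) (r : seq I) (F : I -> T -> R) :
  (forall i, rsummable (F i)) ->
  rsum (fun x => \sum_(i <- r) F i x) = \sum_(i <- r) rsum (F i).
Proof.
move=> sF; elim: r => [|i r IHr].
  by under eq_fun do rewrite big_nil; rewrite rsum0 big_nil.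
under eq_fun do rewrite big_cons.
by rewrite rsumD ?IHr ?big_cons//; exact: rsummable_sum.
Qed.

Lemma rsum_ge1 f y : (forall x, 0 <= f x) -> rsummable f -> f y <= rsum f.
Proof.
by move=> f0 sf; have := @rsum_ge_fin f [:: y] erefl f0 sf; rewrite big_seq1.
Qed.

(** A finite set [s] carries all but [e / 4] of the mass of [g]. On [s] the error is a finite sum,
    eventually below [e / 2]; off [s] it is at most [2 * g], which adds up to at most [e / 2]. *)
Lemma rsum_dct (F : nat -> T -> R) f g :
  (forall n x, `|F n x| <= g x) -> rsummable g ->
  (forall x, F ^~ x @ \oo --> f x) ->
  rsummable f /\ (fun n => rsum (F n)) @ \oo --> rsum f.
Proof.
move=> Fg sg Ff.
have g0 x : 0 <= g x by rewrite (le_trans _ (Fg 0%N x)).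
have fg x : `|f x| <= g x.
  by apply: (cvgr_to_le (cvg_norm (Ff x))); apply: nearW => n; exact: Fg.
have sf := rsummable_le fg sg.
have sF n := rsummable_le (Fg n) sg.
split=> //; apply/cvgrPdist_le => e e0.
have e4 : 0 < e / 4 by rewrite divr_gt0.
have [s us hs] := rsum_approx g0 sg e4.
have cs : (fun n => \sum_(x <- s) `|f x - F n x|) @ \oo --> (\sum_(x <- s) (0 : R)).
  apply: cvg_big => [|x _]; first exact: add_continuous.
  rewrite -[0 : R](@normr0 R R) -(subrr (f x)).
  by apply: cvg_norm; apply: cvgB; [exact: cvg_cst|exact: Ff].
have e2 : 0 < e / 2 by rewrite divr_gt0.
move: cs => /cvgrPdist_le/(_ _ e2); rewrite big1_eq; apply: filterS => n.
rewrite sub0r normrN ger0_norm; last exact: sumr_ge0.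
move=> hn; rewrite -rsumB//.
apply: (le_trans (rsum_norm (rsummableB sf (sF n)))).
pose c x := if x \in s then g x else 0.
pose d x := if x \in s then `|f x - F n x| else 0.
have [|sc Ec] := @rsum_fin c s us; first by move=> x /negbTE; rewrite /c => ->.
have [|sd Ed] := @rsum_fin d s us; first by move=> x /negbTE; rewrite /d => ->.
apply: (@le_trans _ _ (rsum (fun x => d x + 2 * (g x - c x)))).
  apply: ler_rsum.
  - by apply: rsummable_norm; exact: rsummableB.
  - by apply: rsummableD => //; apply: rsummableZ; exact: rsummableB.
  move=> x; rewrite /d /c; case: ifP => _; first by rewrite subrr mulr0 addr0.
  rewrite add0r subr0; have := ler_normB (f x) (F n x).
  by have := fg x; have := Fg n x; lra.
rewrite rsumD//; last by apply: rsummableZ; exact: rsummableB.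
rewrite rsumZ ?rsumB//; last exact: rsummableB.
have -> : rsum c = \sum_(x <- s) g x.
  by rewrite Ec big_seq [RHS]big_seq; apply: eq_bigr => x xs; rewrite /c xs.
have -> : rsum d = \sum_(x <- s) `|f x - F n x|.
  by rewrite Ed big_seq [RHS]big_seq; apply: eq_bigr => x xs; rewrite /d xs.
by lra.
Qed.

End RealSums.

(** * Markov chains on a countable space *)

Section Probability.
Context {R : realType} {T : choiceType}.
Implicit Types (p : T -> R) (f : T -> R).

Definition is_prob p := [/\ forall x, 0 <= p x, rsummable p & rsum p = 1].

Lemma esum_prob p : (forall x, 0 <= p x) ->
  \esum_(x in [set: T]) (p x)%:E = 1%E -> is_prob p.
Proof.
move=> p0 e; have sp : rsummable p by apply/rsummable_esum; rewrite // e ltry.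
by split=> //; apply: EFin_inj; rewrite -rsumE.
Qed.

Lemma rsummable_prob p f (C : R) : is_prob p -> (forall x, `|f x| <= C) ->
  rsummable (fun x => p x * f x).
Proof.
move=> [p0 sp _] fC; apply: (@rsummable_le _ _ _ (fun x => p x * C)).
  by move=> x; rewrite normrM ger0_norm// ler_wpM2l.
exact: rsummableZr.
Qed.

Lemma rsum_prob_cst p C : is_prob p -> rsum (fun x => p x * C) = C.
Proof. by move=> [p0 sp e]; rewrite rsumZr// e mul1r. Qed.

Lemma rsum_prob_norm p f (C : R) : is_prob p -> (forall x, `|f x| <= C) ->
  `|rsum (fun x => p x * f x)| <= C.
Proof.
move=> pp fC; have sf := rsummable_prob pp fC.
apply: (le_trans (rsum_norm sf)); rewrite -[leRHS](rsum_prob_cst C pp).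
have [p0 sp e] := pp.
apply: ler_rsum; [exact: rsummable_norm|exact: rsummableZr|] => x.
by rewrite normrM (ger0_norm (p0 x)) ler_wpM2l.
Qed.

(* By Scheffe's argument pointwise convergence of probability vectors is
   convergence in total variation: [|mu' - mu| = 2 (mu - mu')^+ - (mu - mu')]
   and [(mu - mu')^+ <= mu]. *)
Lemma cvg_rsum_prob (mun : nat -> T -> R) mu (fn : nat -> T -> R) f (C : R) :
  is_prob mu -> (forall n, is_prob (mun n)) ->
  (forall x, mun ^~ x @ \oo --> mu x) ->
  (forall n x, `|fn n x| <= C) -> (forall x, fn ^~ x @ \oo --> f x) ->
  (fun n => rsum (fun x => mun n x * fn n x)) @ \oo
    --> rsum (fun x => mu x * f x).
Proof.
move=> pm pmn mnm fC ff.
have [m0 sm em] := pm.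
have smf n : rsummable (fun x => mu x * fn n x) by exact: rsummable_prob pm (fC n).
have [_ c1] : rsummable (fun x => mu x * f x) /\
    (fun n => rsum (fun x => mu x * fn n x)) @ \oo --> rsum (fun x => mu x * f x).
  refine (@rsum_dct _ _ (fun n x => mu x * fn n x) _ (fun x => mu x * C) _ _ _).
  - by move=> n x; rewrite normrM ger0_norm// ler_wpM2l.
  - exact: rsummableZr.
  - by move=> x; apply: cvgM; [exact: cvg_cst|exact: ff].
pose d n x := Num.max (mu x - mun n x) 0.
have dle n x : `|d n x| <= mu x.
  have [q0 _ _] := pmn n; have := q0 x; have := m0 x.
  by rewrite /d; case: (leP (mu x - mun n x) 0) => ? ? ?; rewrite ger0_norm; lra.
have [_ c2] : rsummable (fun _ : T => 0 : R) /\
    (fun n => rsum (d n)) @ \oo --> rsum (fun _ : T => 0 : R).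
  apply: (rsum_dct dle sm) => x.
  apply/cvgrPdist_le => e e0; move: (mnm x) => /cvgrPdist_le/(_ _ e0).
  apply: filterS => n; rewrite sub0r normrN; apply: le_trans.
  rewrite /d; case: (leP (mu x - mun n x) 0) => h; last by [].
  by rewrite normr0.
rewrite rsum0 in c2.
have bnd n : `|rsum (fun x => mun n x * fn n x) - rsum (fun x => mu x * fn n x)|
    <= (rsum (d n) * 2) * C.
  have [q0 sq eq1] := pmn n.
  have sd : rsummable (d n) := rsummable_le (dle n) sm.
  have sfn := rsummable_prob (pmn n) (fC n).
  rewrite -rsumB//; apply: (le_trans (rsum_norm (rsummableB sfn (smf n)))).
  have -> : rsum (d n) * 2 * C = rsum (fun x => (d n x * 2 - (mu x - mun n x)) * C).
    rewrite rsumZr; last by apply: rsummableB; [exact: rsummableZr|exact: rsummableB].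
    rewrite rsumB; [|exact: rsummableZr|exact: rsummableB].
    by rewrite rsumZr// rsumB// em eq1 subrr subr0.
  apply: ler_rsum.
  - by apply: rsummable_norm; exact: rsummableB.
  - by apply/rsummableZr/rsummableB; [exact: rsummableZr|exact: rsummableB].
  move=> x; rewrite -mulrBl normrM ler_pM//.
  rewrite /d; case: (leP (mu x - mun n x) 0) => h.
    by rewrite ger0_norm; lra.
  by rewrite ltr0_norm; lra.
have c3 : (fun n => rsum (fun x => mun n x * fn n x) - rsum (fun x => mu x * fn n x))
    @ \oo --> (0 : R).
  apply/cvgrPdist_le => e e0.
  have : (fun n => rsum (d n) * 2 * C) @ \oo --> 0 * 2 * C.
    by apply: cvgM; [apply: cvgM => //; exact: cvg_cst|exact: cvg_cst].
  rewrite !mul0r => /cvgrPdist_le/(_ _ e0); apply: filterS => n.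
  rewrite !sub0r !normrN; apply: le_trans; apply: (le_trans (bnd n)).
  exact: ler_norm.
have -> : (fun n => rsum (fun x => mun n x * fn n x)) = (fun n =>
    (rsum (fun x => mun n x * fn n x) - rsum (fun x => mu x * fn n x)) +
    rsum (fun x => mu x * fn n x)) by apply/funext => n; rewrite subrK.
by rewrite -[X in _ --> X]add0r; exact: (cvgD c3 c1).
Qed.

End Probability.

Section Markov.
Context {R : realType} {T : choiceType}.
Variable P : T -> T -> R.
Hypothesis hP : stochastic P.
Implicit Types (f : T -> R) (mu : T -> R).

Lemma stochastic_prob x : is_prob (P x).
Proof. by case: hP => P0 P1; apply: esum_prob. Qed.

Lemma stationary_prob mu : stationary_distribution P mu -> is_prob mu.
Proof. by move=> [m0 m1 _]; exact: esum_prob. Qed.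

(** For nonnegative functions this is Tonelli's theorem. A bounded [f] is replaced by [f + C], and
    averaging against probability vectors adds the same [C] on both sides. *)
Lemma rsum_stationary mu f (C : R) : stationary_distribution P mu ->
  (forall x, `|f x| <= C) ->
  rsum (fun x => mu x * rsum (fun y => P x y * f y)) = rsum (fun x => mu x * f x).
Proof.
move=> hmu; have pm := stationary_prob hmu; have [m0 sm em] := pm.
have P0 x y : 0 <= P x y by case: hP.
have key g : (forall x, 0 <= g x) -> (forall x, `|g x| <= C *+ 2) ->
    rsum (fun x => mu x * rsum (fun y => P x y * g y)) = rsum (fun x => mu x * g x).
  move=> g0 gC.
  have sPg x := rsummable_prob (stochastic_prob x) gC.
  have Pg0 x : 0 <= rsum (fun y => P x y * g y).
    by apply: rsum_ge0 => y; rewrite mulr_ge0.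
  have sm1 : rsummable (fun x => mu x * rsum (fun y => P x y * g y)).
    apply: (rsummable_prob pm) => x; exact: rsum_prob_norm (stochastic_prob x) gC.
  have sm2 := rsummable_prob pm gC.
  apply: EFin_inj; rewrite -!rsumE//; try by move=> x; rewrite mulr_ge0.
  transitivity (\esum_(x in [set: T]) \esum_(y in [set: T]) (mu x * (P x y * g y))%:E).
    apply: eq_esum => x _; rewrite -rsumZ// rsumE//; last exact: rsummableZ.
    by move=> y; rewrite !mulr_ge0.
  transitivity (\esum_(y in [set: T]) \esum_(x in [set: T]) (mu x * (P x y * g y))%:E).
    rewrite !esum_esum//; do ?by move=> ? ? _ _; rewrite lee_fin !mulr_ge0.
    rewrite (reindex_esum ([set: T] `*`` (fun=> [set: T])) _ (fun x => (x.2, x.1)))//.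
    split=> //=; first by move=> [i1 i2] [j1 j2] /= _ _ [] -> ->.
    by move=> [i1 i2] _; exists (i2, i1).
  apply: eq_esum => y _.
  have [_ _ /(_ y) st] := hmu.
  have mP0 x : 0 <= mu x * P x y by rewrite mulr_ge0.
  have smP : rsummable (fun x => mu x * P x y) by apply/rsummable_esum; rewrite // st ltry.
  rewrite (_ : mu y = rsum (fun x => mu x * P x y)); last by apply: EFin_inj; rewrite -rsumE.
  rewrite -rsumZr// -rsumE; last exact: rsummableZr.
    by apply: eq_esum => x _; rewrite mulrA.
  by move=> x; rewrite !mulr_ge0.
move=> fC.
have C0 x : 0 <= C := le_trans (normr_ge0 _) (fC x).
have fC2 x : -C <= f x <= C by rewrite -ler_norml.
have shift p g : is_prob p -> rsummable (fun x => p x * g x) ->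
    rsum (fun x => p x * (g x + C)) = rsum (fun x => p x * g x) + C.
  move=> pp spg; have [_ sp _] := pp.
  under eq_fun do rewrite mulrDr.
  by rewrite rsumD ?rsum_prob_cst//; exact: rsummableZr.
have sPf x := rsummable_prob (stochastic_prob x) fC.
have PE x : rsum (fun y => P x y * (f y + C)) = rsum (fun y => P x y * f y) + C.
  by apply: shift => //; exact: stochastic_prob.
apply: (addIr C); rewrite -!shift//; last 2 first.
- exact: rsummable_prob pm fC.
- by apply: (rsummable_prob pm) => x; exact: rsum_prob_norm (stochastic_prob x) fC.
under eq_fun do rewrite -PE.
apply: key => x; have /andP[h1 h2] := fC2 x; first by rewrite -lerBlDr sub0r.
by rewrite ger0_norm ?mulr2n ?lerD2r// -lerBlDr sub0r.
Qed.

Lemma esum_gt0_ex (a : T -> \bar R) : (forall x, (0 <= a x)%E) ->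
  (0 < \esum_(x in [set: T]) a x)%E -> exists x, (0 < a x)%E.
Proof.
move=> a0; apply: contraPP => /forallNP h; rewrite esum1 ?ltxx// => x _.
by apply/eqP; rewrite eq_le a0 andbT leNgt; apply/negP/h.
Qed.

Lemma nstep_ge0 n x y : (0 <= nstep P n x y)%E.
Proof.
elim: n x => [|n IHn] x /=; first by rewrite lee_fin.
by apply: esum_ge0 => z _; rewrite mule_ge0// lee_fin; case: hP.
Qed.

Lemma nstepS_gt0 n x y : (0 < nstep P n.+1 x y)%E ->
  exists z, 0 < P x z /\ (0 < nstep P n z y)%E.
Proof.
have P0 u v : 0 <= P u v by case: hP.
move=> /= /esum_gt0_ex[|z].
  by move=> z; rewrite mule_ge0 ?nstep_ge0// lee_fin.
have := P0 x z; rewrite le_eqVlt => /predU1P[<-|Pz]; first by rewrite mul0e ltxx.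
have := nstep_ge0 n z y; rewrite le_eqVlt => /predU1P[<-|nz]; first by rewrite mule0 ltxx.
by exists z.
Qed.

(** Some state carries mass because the total is 1, and stationarity carries positivity along a path
    of positive probability. *)
Lemma stationary_gt0 mu : irreducible P -> stationary_distribution P mu ->
  forall x, 0 < mu x.
Proof.
move=> irr hmu y; have [m0 m1 st] := hmu.
have [x mx] : exists x, 0 < mu x.
  have [||x] := @esum_gt0_ex (fun x => (mu x)%:E).
  - by move=> x; rewrite lee_fin.
  - by rewrite m1 lte01.
  - by rewrite lte_fin => ?; exists x.
have [n] := irr x y; elim: n x mx => [|n IHn] x mx.
  by rewrite /= lte_fin; have [<-//|_] := eqVneq; rewrite ltxx.
move=> /nstepS_gt0[z [Pz nz]]; apply: (IHn z) => //.
have mP0 u : 0 <= mu u * P u z by rewrite mulr_ge0//; case: hP.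
have smP : rsummable (fun u => mu u * P u z) by apply/rsummable_esum; rewrite // st ltry.
rewrite (_ : mu z = rsum (fun u => mu u * P u z)); last by apply: EFin_inj; rewrite -rsumE.
by rewrite (lt_le_trans _ (rsum_ge1 x mP0 smP))// mulr_gt0.
Qed.

(** * Visits before a taboo state and bounded solutions of the Poisson equation *)

Section Poisson.
Variables a y : T.

(* Expected number of visits to [y] during the first [n] steps before the
   chain enters [a]. *)
Fixpoint taboo_visits (n : nat) (x : T) : R :=
  if n is n'.+1 then
    if x == a then 0 else (x == y)%:R + rsum (fun z => P x z * taboo_visits n' z)
  else 0.

(* Probability of avoiding [a] during [n] steps. *)
Fixpoint avoid (n : nat) (x : T) : R :=
  if x == a then 0 else
  if n is n'.+1 then rsum (fun z => P x z * avoid n' z) else 1.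

Let P0 x z : 0 <= P x z. Proof. by case: hP. Qed.

Lemma rsum_row_le x f g (B C : R) : (forall z, `|f z| <= B) -> (forall z, `|g z| <= C) ->
  (forall z, f z <= g z) ->
  rsum (fun z => P x z * f z) <= rsum (fun z => P x z * g z).
Proof.
move=> fB gC fg; apply: ler_rsum => [||z]; last by rewrite ler_wpM2l.
- exact: rsummable_prob (stochastic_prob x) fB.
- exact: rsummable_prob (stochastic_prob x) gC.
Qed.

Lemma rsum_row_bounds x f (C : R) : 0 <= C -> (forall z, 0 <= f z <= C) ->
  0 <= rsum (fun z => P x z * f z) <= C.
Proof.
move=> C0 fC; have fN z : `|f z| <= C by have /andP[? ?] := fC z; rewrite ger0_norm.
have := rsum_prob_norm (stochastic_prob x) fN.
rewrite rsum_ge0 /=; last by move=> z; rewrite mulr_ge0//; have /andP[] := fC z.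
exact/le_trans/ler_norm.
Qed.

Lemma avoid_bounds n x : 0 <= avoid n x <= 1.
Proof.
elim: n x => [|n IHn] x /=; case: eqP => _; rewrite ?lexx ?ler01//.
exact: rsum_row_bounds.
Qed.

Lemma avoid_norm n x : `|avoid n x| <= 1.
Proof. by have /andP[? ?] := avoid_bounds n x; rewrite ger0_norm. Qed.

Lemma avoid_lt1 n x : (0 < nstep P n x a)%E -> avoid n x < 1.
Proof.
elim: n x => [|n IHn] x.
  by rewrite /= lte_fin; case: eqP; rewrite ?ltxx// ltr01.
move=> /nstepS_gt0[z [Pz nz]] /=; case: eqP => _; first exact: ltr01.
have sq := rsummable_prob (stochastic_prob x) (avoid_norm n).
have [_ sp e1] := stochastic_prob x.
rewrite -subr_gt0 -[1]e1 -rsumB//.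
apply: (@lt_le_trans _ _ (P x z - P x z * avoid n z)).
  by rewrite -[X in X - _]mulr1 -mulrBr mulr_gt0// subr_gt0 IHn.
apply: (rsum_ge1 (f := fun u => P x u - P x u * avoid n u)) => [u|]; last exact: rsummableB.
rewrite subr_ge0 ler_piMr//; by have /andP[] := avoid_bounds n u.
Qed.

Lemma taboo_visitsS n x : taboo_visits n.+1 x =
  if x == a then 0 else (x == y)%:R + rsum (fun z => P x z * taboo_visits n z).
Proof. by []. Qed.

Lemma taboo_visits_bounds n x : 0 <= taboo_visits n x <= n%:R.
Proof.
elim: n x => [|n IHn] x /=; first by rewrite lexx.
case: eqP => _; first by rewrite lexx ler0n.
have /andP[h1 h2] := rsum_row_bounds x (ler0n R n) IHn.
by rewrite addr_ge0//= -natr1 addrC lerD// lern1; case: eqP.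
Qed.

Lemma taboo_visits_norm n x : `|taboo_visits n x| <= n%:R.
Proof. by have /andP[? ?] := taboo_visits_bounds n x; rewrite ger0_norm. Qed.

Lemma taboo_visits_ndS n x : taboo_visits n x <= taboo_visits n.+1 x.
Proof.
elim: n x => [|n IHn] x; first by have /andP[] := taboo_visits_bounds 1 x.
rewrite !(taboo_visitsS _ x); case: eqP => // _; rewrite lerD2l.
by apply: rsum_row_le; [exact: taboo_visits_norm|exact: (taboo_visits_norm n.+1)|].
Qed.

(** A maximum principle: away from [y] nothing is counted at time 0, so the value is an average of
    values which, by induction, do not exceed the one at [y]. *)
Lemma taboo_visits_max n x : taboo_visits n x <= taboo_visits n y.
Proof.
elim: n x => [|n IHn] x //.
have h z : taboo_visits n z <= taboo_visits n.+1 y := le_trans (IHn z) (taboo_visits_ndS _ _).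
have [<-//|xy] := eqVneq x y.
have u0 : 0 <= taboo_visits n.+1 y by have /andP[] := taboo_visits_bounds n.+1 y.
rewrite (taboo_visitsS n x); case: eqP => // _; rewrite (negbTE xy) add0r.
have hb z : 0 <= taboo_visits n z <= taboo_visits n.+1 y.
  by rewrite h andbT; have /andP[] := taboo_visits_bounds n z.
by have /andP[] := rsum_row_bounds x u0 hb.
Qed.

(** Split the visits at time [m]: at most [m] of them come earlier, and the later ones count only if
    [a] has been avoided so far, with mean at most the maximum [taboo_visits n y]. *)
Lemma taboo_visits_avoid m n x :
  taboo_visits (m + n) x <= m%:R + taboo_visits n y * avoid m x.
Proof.
have u0 k : 0 <= taboo_visits k y by have /andP[] := taboo_visits_bounds k y.
elim: m x => [|m IHm] x.
  rewrite add0n add0r; have [->|xa] := eqVneq x a.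
    by rewrite /= eqxx mulr0; case: n => //= n; rewrite eqxx.
  by rewrite /= (negbTE xa) mulr1 taboo_visits_max.
rewrite addSn /=; case: eqP => _; first by rewrite mulr0 addr0 ler0n.
have hn z : `|m%:R + taboo_visits n y * avoid m z| <= m%:R + taboo_visits n y.
  have /andP[? ?] := avoid_bounds m z.
  rewrite ger0_norm; last by rewrite addr_ge0// mulr_ge0.
  by rewrite lerD2l ler_piMr.
have := rsum_row_le x (taboo_visits_norm (m + n)) hn IHm.
have sq := rsummable_prob (stochastic_prob x) (avoid_norm m).
have [_ sp e1] := stochastic_prob x.
have -> : rsum (fun z => P x z * (m%:R + taboo_visits n y * avoid m z))
    = m%:R + taboo_visits n y * rsum (fun z => P x z * avoid m z).
  under eq_fun do rewrite mulrDr mulrCA.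
  rewrite rsumD; [|exact: rsummableZr|exact: rsummableZ].
  by rewrite rsumZ// rsum_prob_cst//; exact: stochastic_prob.
have : (x == y)%:R <= 1 :> R by case: eqP => _; rewrite ?lexx ?ler01.
by rewrite -natr1; lra.
Qed.

(* The solution is the mean number of visits to [y] before [a].  It is largest
   at [y], and from [y] the chain meets [a] within [m] steps with positive
   probability, whence the bound [m / (1 - avoid m y)]. *)
Lemma poisson_bounded : (exists n, (0 < nstep P n y a)%E) ->
  exists (w : T -> R) (c B : R), (forall x, `|w x| <= B) /\
    forall x, w x - rsum (fun z => P x z * w z) = (x == y)%:R - c * (x == a)%:R.
Proof.
move=> [m /avoid_lt1 q1].
pose B := m%:R / (1 - avoid m y).
have ub n x : taboo_visits n x <= B.
  apply: (le_trans (taboo_visits_max n x)).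
  rewrite ler_pdivlMr ?subr_gt0//.
  have nd : taboo_visits n y <= taboo_visits (m + n) y.
    elim: m {q1 B} => // k IHk; apply: (le_trans IHk); exact: taboo_visits_ndS.
  by have := le_trans nd (taboo_visits_avoid m n y); lra.
have un n x : `|taboo_visits n x| <= B.
  by have /andP[? _] := taboo_visits_bounds n x; rewrite ger0_norm.
pose w x := limn (taboo_visits ^~ x).
have cw x : taboo_visits ^~ x @ \oo --> w x.
  apply: nondecreasing_is_cvgn.
    by apply/nondecreasing_seqP => n; exact: taboo_visits_ndS.
  by exists B => _ [n _ <-].
have wB x : `|w x| <= B.
  by apply: (cvgr_to_le (cvg_norm (cw x))); apply: nearW => n; exact: un.
have cPw x : (fun n => rsum (fun z => P x z * taboo_visits n z)) @ \oo
    --> rsum (fun z => P x z * w z).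
  have [p0 sp _] := stochastic_prob x.
  refine (proj2 (@rsum_dct _ _ (fun n z => P x z * taboo_visits n z) _ (fun z => P x z * B) _ _ _)) => //.
  - by move=> n z; rewrite normrM ger0_norm// ler_wpM2l.
  - exact: rsummableZr.
  - by move=> z; apply: cvgM; [exact: cvg_cst|exact: cw].
(* Since [w] vanishes at [a], the equation at [a] forces [c]: it is the mean number of visits to [y]
   in an excursion from [a], the starting point included. *)
exists w, ((a == y)%:R + rsum (fun z => P a z * w z)), B; split=> // x.
have cS : (fun n => taboo_visits n.+1 x) @ \oo --> w x.
  by have := cw x; rewrite -(cvg_shiftS (taboo_visits ^~ x)).
have [->|xa] := eqVneq x a.
  have -> : w a = 0.
    rewrite /w (_ : taboo_visits ^~ a = cst 0) ?lim_cst//.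
    by apply/funext => -[|n]//=; rewrite eqxx.
  by rewrite mulr1; lra.
have -> : w x = (x == y)%:R + rsum (fun z => P x z * w z).
  apply: (cvg_unique _ cS) => //=.
  by rewrite (negbTE xa); apply: cvgD; [exact: cvg_cst|exact: cPw].
by rewrite mulr0; lra.
Qed.

End Poisson.

(* The mean drift vanishes even when [mu V] is infinite: truncating [V] at [n]
   makes the identity one about bounded functions, and the drifts of the
   truncations are bounded by [C] and converge to the drift of [V]. *)
Lemma rsum_drift mu (V : T -> R) (C : R) : stationary_distribution P mu ->
  0 <= C -> (forall x, 0 <= V x) ->
  (forall x, rsummable (fun y => P x y * V y)) ->
  (forall x, rsum (fun y => P x y * V y) <= V x + C) ->
  (forall x y, 0 < P x y -> V x - C <= V y) ->
  rsummable (fun x => mu x * (rsum (fun y => P x y * V y) - V x)) /\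
  rsum (fun x => mu x * (rsum (fun y => P x y * V y) - V x)) = 0.
Proof.
move=> hmu C0 V0 sV up dn; have pm := stationary_prob hmu; have [m0 sm em] := pm.
have P0 x z : 0 <= P x z by case: hP.
pose Vn n x := Num.min (V x) n%:R.
have Vn0 n x : 0 <= Vn n x by rewrite le_min V0 ler0n.
have VnV n x : Vn n x <= V x by rewrite ge_min lexx.
have Vnn n x : Vn n x <= n%:R by rewrite ge_min lexx orbT.
have VnN n x : `|Vn n x| <= n%:R by rewrite ger0_norm.
have cVn x : Vn ^~ x @ \oo --> V x.
  apply: cvg_near_cst; near=> n; apply/min_idPl.
  by near: n; exact: nbhs_infty_ger.
pose F n x := mu x * (rsum (fun y => P x y * Vn n y) - Vn n x).
have sVn n x := rsummable_prob (stochastic_prob x) (VnN n).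
have FC n x : `|F n x| <= mu x * C.
  rewrite /F normrM ger0_norm// ler_wpM2l// ler_norml.
  have [p0 sp e1] := stochastic_prob x.
  have h1 : rsum (fun y => P x y * (Vn n x - C)) <= rsum (fun y => P x y * Vn n y).
    apply: ler_rsum => //; first exact: rsummableZr.
    move=> y; have [Pxy|] := ltP 0 (P x y); last first.
      by move=> h; rewrite (_ : P x y = 0) ?mul0r//; apply/eqP; rewrite eq_le h P0.
    rewrite ler_wpM2l// /Vn le_min; have := dn _ _ Pxy; have := VnV n x; have := Vnn n x.
    by rewrite -/(Vn n x) => ? ? ?; apply/andP; split; lra.
  rewrite (rsum_prob_cst _ (stochastic_prob x)) in h1.
  have h2 : rsum (fun y => P x y * Vn n y) <= V x + C.
    apply: le_trans (up x); apply: ler_rsum => // y; exact: ler_wpM2l.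
  have h3 : rsum (fun y => P x y * Vn n y) <= n%:R.
    rewrite -[leRHS](rsum_prob_cst _ (stochastic_prob x)).
    by apply: ler_rsum => //; [exact: rsummableZr|move=> y; exact: ler_wpM2l].
  (* If [V x <= n] the drift of [V] itself gives the bound; otherwise [Vn n] is everywhere at most
     [n], its value at [x]. *)
  have h4 : rsum (fun y => P x y * Vn n y) <= Vn n x + C.
    by rewrite {2}/Vn; case: (leP (V x) n%:R) => _; lra.
  by apply/andP; split; lra.
have [|sl cF] := @rsum_dct _ _ F (fun x => mu x * (rsum (fun y => P x y * V y) - V x))
    _ FC (rsummableZr C sm).
  move=> x; apply: cvgM; first exact: cvg_cst.
  apply: cvgB; last exact: cVn.
  refine (proj2 (@rsum_dct _ _ (fun n y => P x y * Vn n y) _ (fun y => P x y * V y) _ _ _)) => //.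
  - by move=> n y; rewrite ger0_norm ?ler_wpM2l// mulr_ge0.
  - by move=> y; apply: cvgM; [exact: cvg_cst|exact: cVn].
split=> //; apply/esym; apply: (cvg_unique _ _ cF) => //.
rewrite (_ : (fun n => _) = cst 0); first exact: cvg_cst.
apply/funext => n /=; rewrite /F.
under eq_fun do rewrite mulrBr.
rewrite rsumB ?(rsum_stationary hmu (VnN n)) ?subrr//; last exact: rsummable_prob pm (VnN n).
by apply: (rsummable_prob pm) => x; exact: rsum_prob_norm (stochastic_prob x) (VnN n).
Unshelve. all: by end_near. Qed.

End Markov.

(** * The level structure of the state space *)

Section Levels.
Context {R : realType} {M0 M1 : nat}.
Local Notation S := (mg1_state M0 M1).
Implicit Types (f g : S -> R) (x y : S).

Definition St (k : nat) (i : 'I_(lev M0 M1 k)) : S :=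
  existT (fun k => 'I_(lev M0 M1 k)) k i.

Definition lvl x : nat := tag x.
(** The phase is a natural number and not an element of ['I_(lev M0 M1 k)], so that one function of
    the phase applies on all levels. *)
Definition ph x : nat := tagged x.

Definition levels n : seq S :=
  [seq St i | k <- iota 0 n, i <- enum 'I_(lev M0 M1 k)].

Lemma mem_levels n x : (x \in levels n) = (lvl x < n)%N.
Proof.
apply/allpairsPdep/idP => [[k [i [+ _ ->]]]|].
  by rewrite mem_iota.
by case: x => k i kn; exists k, i; rewrite mem_iota mem_enum.
Qed.

Lemma uniq_levels n : uniq (levels n).
Proof.
apply: allpairs_uniq_dep; first exact: iota_uniq.
  by move=> k _; exact: enum_uniq.
by move=> [k1 i1] [k2 i2] _ _.
Qed.

Lemma sum_levels n f :
  \sum_(x <- levels n) f x = \sum_(0 <= k < n) \sum_(i < lev M0 M1 k) f (St i).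
Proof.
rewrite /levels big_allpairs_dep /index_iota subn0; apply: eq_bigr => k _.
by rewrite big_enum.
Qed.

Lemma rsum_levels n f : (forall x, (n <= lvl x)%N -> f x = 0) ->
  rsummable f /\ rsum f = \sum_(0 <= k < n) \sum_(i < lev M0 M1 k) f (St i).
Proof.
move=> f0; rewrite -sum_levels; apply: rsum_fin; first exact: uniq_levels.
by move=> x; rewrite mem_levels -leqNgt; exact: f0.
Qed.

Lemma cvg_levels f : rsummable f ->
  (fun n => \sum_(0 <= k < n) \sum_(i < lev M0 M1 k) f (St i)) @ \oo --> rsum f.
Proof.
move=> sf; pose F n x := if (lvl x < n)%N then f x else 0.
have FE n : rsum (F n) = \sum_(0 <= k < n) \sum_(i < lev M0 M1 k) f (St i).
  have [|_ ->] := @rsum_levels n (F n).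
    by move=> x; rewrite /F ltnNge => ->.
  by apply: eq_big_nat => k /andP[_ kn]; apply: eq_bigr => i _; rewrite /F /lvl/= kn.
under eq_fun do rewrite -FE.
refine (proj2 (@rsum_dct _ _ F _ (fun x => `|f x|) _ _ _)).
- by move=> n x; rewrite /F; case: ifP; rewrite ?normr0.
- exact: rsummable_norm.
move=> x; apply: cvg_near_cst; near=> n; rewrite /F ifT//.
by near: n; exact: nbhs_infty_gt.
Unshelve. all: by end_near. Qed.

Lemma rsummable_levels f C :
  (forall n, \sum_(0 <= k < n) \sum_(i < lev M0 M1 k) `|f (St i)| <= C) ->
  rsummable f.
Proof.
move=> fC; apply: (@rsummable_bound _ _ _ C) => s us.
pose n := (\max_(x <- s) lvl x).+1.
pose g x := if (lvl x < n)%N then `|f x| else 0.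
have [|sg Eg] := @rsum_levels n g; first by move=> x; rewrite /g ltnNge => ->.
apply: le_trans (fC n).
have -> : \sum_(0 <= k < n) \sum_(i < lev M0 M1 k) `|f (St i)| = rsum g.
  by rewrite Eg; apply: eq_big_nat => k /andP[_ kn]; apply: eq_bigr => i _; rewrite /g /lvl/= kn.
have -> : \sum_(x <- s) `|f x| = \sum_(x <- s) g x.
  rewrite big_seq [RHS]big_seq; apply: eq_bigr => x xs.
  by rewrite /g ltnS leq_bigmax_seq.
by apply: rsum_ge_fin => // x; rewrite /g; case: ifP.
Qed.

Lemma ph_lt x : (0 < lvl x)%N -> (ph x < M1)%N.
Proof. by case: x => -[//|k] i _; exact: ltn_ord. Qed.

Lemma sum_ph x (g : nat -> R) : (0 < lvl x)%N ->
  \sum_(j < M1) (if ph x == j then g j else 0) = g (ph x).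
Proof.
move=> x0; rewrite (bigD1 (Ordinal (ph_lt x0)))//= eqxx big1 ?addr0// => j jx.
by case: eqP => // e; case/eqP: jx; apply/val_inj.
Qed.

(** Bridge between the two kinds of sums: [mx_series] takes a limit along the levels in a fixed
    phase, [rsum] adds over all states. Summability provides the convergence that gives [limn] its
    meaning. *)
Lemma cvg_phase f m (j : 'I_M1) : rsummable f ->
  series (fun l => f (@St (m + l).+1 j)) @ \oo
    --> rsum (fun x => if (m < lvl x)%N && (ph x == j) then f x else 0).
Proof.
move=> sf; pose g x := if (m < lvl x)%N && (ph x == j) then f x else 0.
have sg : rsummable g.
  apply: (rsummable_le _ (rsummable_norm sf)) => x.
  by rewrite /g; case: ifP; rewrite ?normr0.
pose G k := \sum_(i < lev M0 M1 k) g (St i).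
have := cvg_levels sg; rewrite -(cvg_shiftn m.+1)/=.
suff -> : (fun n => \sum_(0 <= k < n + m.+1) G k) = series (fun l => f (@St (m + l).+1 j)) by [].
apply/funext => n; rewrite (@big_cat_nat _ _ _ m.+1)//=; last exact: leq_addl.
rewrite [X in X + _]big1_seq ?add0r; last first.
  move=> k; rewrite mem_index_iota => /andP[_ /andP[_ km]].
  by rewrite /G big1// => i _; rewrite /g /lvl/= ltnNge -ltnS km.
rewrite -{1}[m.+1]add0n big_addn addnK /series/=; apply: eq_bigr => l _.
have -> : (l + m.+1 = (m + l).+1)%N by lia.
rewrite /G (bigD1 j)//= big1 ?addr0.
  by rewrite /g /lvl /ph/= eqxx ltnS leq_addr.
by move=> i /eqP ij; rewrite /g /ph/= andbC; case: eqP => //= /val_inj.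
Qed.

Lemma sum_lt_nat n a L : \sum_(0 <= l < n) ((a + l < L)%N)%:R = (minn n (L - a))%:R :> R.
Proof.
elim: n => [|n IHn]; first by rewrite big_nil min0n.
by rewrite big_nat_recr//= IHn -natrD; congr _%:R; case: ltnP; lia.
Qed.

(* Summation by layers: [(L - a)^+] counts the [l >= 0] with [a + l < L]. *)
Lemma cvg_layers (p : S -> R) a (j : 'I_M1) : (forall x, 0 <= p x) ->
  rsummable (fun x => p x * (lvl x)%:R) -> rsummable p ->
  series (fun l => rsum (fun x => if (a + l < lvl x)%N && (ph x == j) then p x else 0))
    @ \oo --> rsum (fun x => if ph x == j then p x * (lvl x - a)%N%:R else 0).
Proof.
move=> p0 sp1 sp.
pose F n x := if ph x == j then p x * (minn n (lvl x - a))%:R else 0.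
have FE n : series (fun l => rsum (fun x =>
    if (a + l < lvl x)%N && (ph x == j) then p x else 0)) n = rsum (F n).
  rewrite /series/= -rsum_sum.
    congr rsum; apply/funext => x; rewrite /F; case: eqP => _; last first.
      by rewrite big1// => l _; rewrite andbF.
    rewrite -sum_lt_nat mulr_sumr; apply: eq_bigr => l _.
    by rewrite andbT; case: ifP; rewrite ?mulr1 ?mulr0.
  move=> l; apply: (rsummable_le _ sp) => x.
  by case: ifP; rewrite ?normr0// ger0_norm.
rewrite (funext FE).
refine (proj2 (@rsum_dct _ _ F _ (fun x => p x * (lvl x)%:R) _ _ _)) => //.
- move=> n x; rewrite /F; case: ifP; rewrite ?normr0 ?mulr_ge0// => _.
  rewrite ger0_norm ?mulr_ge0// ler_wpM2l// ler_nat.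
  by rewrite (leq_trans (geq_minr _ _))// leq_subr.
- move=> x; apply: cvg_near_cst; near=> n; rewrite /F; case: ifP => // _.
  congr (_ * _%:R); apply/minn_idPr; near: n; exact: nbhs_infty_ge.
Unshelve. all: by end_near. Qed.

End Levels.

(** * Rows of an M/G/1-type matrix *)

Lemma rsum_fintype {R : realType} {T : finType} (f : T -> R) :
  rsummable f /\ rsum f = \sum_x f x.
Proof.
rewrite -big_enum; apply: rsum_fin; first exact: enum_uniq.
by move=> x; rewrite mem_enum.
Qed.

Section Rows.
Context {R : realType} {M0 M1 : nat}.
Variable X : mg1_blocks R M0 M1.
Hypothesis hP : stochastic (mg1_mx X).
Local Notation P := (mg1_mx X).
Local Notation S := (mg1_state M0 M1).
Local Notation a d i j := (blkA X (d%:Z - 1) i j).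
Implicit Types (x y : S) (b : nat -> R).

Lemma mg1_mx_ge0 x y : 0 <= P x y. Proof. by case: hP. Qed.

Lemma rsummable_row x : rsummable (P x).
Proof. by case: (stochastic_prob hP x). Qed.

Lemma mg1_mxE (Y : mg1_blocks R M0 M1) k l (i j : 'I_M1) :
  mg1_mx Y (@St M0 M1 k.+1 i) (@St M0 M1 l.+1 j)
  = if (k.+1 <= l.+2)%N then blkA Y (l.+1%:Z - k.+1%:Z) i j else 0.
Proof. by case: k i => [|k] i; rewrite /mg1_mx//=; case: ifP; rewrite ?mxE. Qed.

Lemma mg1_mx_skip (Y : mg1_blocks R M0 M1) x y :
  ((lvl y).+1 < lvl x)%N -> mg1_mx Y x y = 0.
Proof.
case: x y => [[|[|k]] i] [[|l] j]; rewrite /lvl//= => h.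
  by rewrite /mg1_mx/= mxE.
by rewrite (mg1_mxE Y k.+1) leqNgt h.
Qed.

Lemma tailA_row k i m j : tailA X m i j =
  rsum (fun y => if (k.+1 + m < lvl y)%N && (ph y == j) then P (@St M0 M1 k.+1 i) y else 0).
Proof.
rewrite /tailA /mx_tail /mx_series mxE; apply/cvg_lim => //.
have := @cvg_phase _ _ _ _ (k.+1 + m) j (rsummable_row (@St M0 M1 k.+1 i)).
suff -> : (fun l => P (@St M0 M1 k.+1 i) (@St M0 M1 (k.+1 + m + l).+1 j))
  = (fun l => blkA X (m + l).+1%:Z i j) by [].
apply/funext => l; rewrite mg1_mxE ifT; last by lia.
by congr (blkA X _ i j); lia.
Qed.

Lemma tailB_row i m j : tailB X m i j =
  rsum (fun y => if (m < lvl y)%N && (ph y == j) then P (@St M0 M1 0 i) y else 0).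
Proof.
rewrite /tailB /mx_series mxE; apply/cvg_lim => //.
exact: (@cvg_phase _ _ _ _ m j (rsummable_row (@St M0 M1 0 i))).
Qed.

(* Truncated subtraction gives the positive part of [lvl y - lvl x - N]. *)
Definition overshoot x N := rsum (fun y => P x y * (lvl y - (lvl x + N))%N%:R).

Definition row_moment := forall x, rsummable (fun y => P x y * (lvl y)%:R).

Lemma sum_overshoot x c : row_moment ->
  \sum_(j < M1) rsum (fun y => if ph y == j then P x y * (lvl y - c)%N%:R else 0)
  = rsum (fun y => P x y * (lvl y - c)%N%:R).
Proof.
move=> hm; rewrite -rsum_sum.
  congr rsum; apply/funext => y; have [y0|y0] := posnP (lvl y).
    by rewrite y0 sub0n mulr0 big1// => j _; case: ifP.
  by rewrite (sum_ph (fun=> P x y * (lvl y - c)%N%:R)).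
move=> j; apply: (rsummable_le _ (hm x)) => y.
have p0 := mg1_mx_ge0 x y; case: ifP => _; last by rewrite normr0 mulr_ge0.
by rewrite ger0_norm ?mulr_ge0// ler_wpM2l// ler_nat leq_subr.
Qed.

(** Summation by layers. The threshold is [N.+1] because the double tail at [N] weights the
    increment [m] by the positive part of [m - (N + 1)]. The free [k] shows that the overshoot does
    not depend on which positive level is left. *)
Lemma tail2A_overshoot k i N : row_moment ->
  (tail2A X N *m ones R M1) i ord0 = overshoot (@St M0 M1 k.+1 i) N.+1.
Proof.
move=> hm; rewrite mxE /overshoot -sum_overshoot//; apply: eq_bigr => j _.
rewrite [ones _ _ _ _]mxE mulr1 /tail2A /mx_tail /mx_series mxE; apply/cvg_lim => //.
have -> : (fun l => tailA X (N + l).+1 i j) = (fun l => rsum (fun y =>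
    if (k.+1 + N.+1 + l < lvl y)%N && (ph y == j) then P (@St M0 M1 k.+1 i) y else 0)).
  by apply/funext => l; rewrite (tailA_row k) addnS -addnA -addnS.
exact: cvg_layers (mg1_mx_ge0 _) (hm _) (rsummable_row _).
Qed.

Lemma tail2B_overshoot i N : row_moment ->
  (tail2B X N *m ones R M1) i ord0 = overshoot (@St M0 M1 0 i) N.+1.
Proof.
move=> hm; rewrite mxE /overshoot -sum_overshoot//; apply: eq_bigr => j _.
rewrite [ones _ _ _ _]mxE mulr1 /tail2B /mx_tail /mx_series mxE; apply/cvg_lim => //.
have -> : (fun l => tailB X (N + l).+1 i j) = (fun l => rsum (fun y =>
    if (N.+1 + l < lvl y)%N && (ph y == j) then P (@St M0 M1 0 i) y else 0)).
  by apply/funext => l; rewrite tailB_row addSn.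
exact: cvg_layers (mg1_mx_ge0 _) (hm _) (rsummable_row _).
Qed.

Lemma row_up l k d i (phi : nat -> nat -> R) : l = (k + d)%N -> (0 < l)%N ->
  \sum_(j < lev M0 M1 l) P (@St M0 M1 k.+1 i) (St j) * phi l j =
  \sum_(j < M1) a d i j * phi l j.
Proof.
case: l => [//|l] e _; apply: eq_bigr => j _; congr (_ * _).
rewrite mg1_mxE ifT; last by lia.
by congr (blkA X _ i j); lia.
Qed.

(** Level 2 is the lowest level whose rows contain all the blocks [A(-1), A(0), ...]: from level 1
    the step down is governed by [blkBm1]. Facts about the whole sequence are therefore read off a
    row of level 2. *)
Lemma blkA_ge0 d i j : 0 <= a d i j.
Proof.
have := mg1_mx_ge0 (@St M0 M1 2 i) (@St M0 M1 d.+1 j).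
rewrite (mg1_mxE X 1) (_ : d.+1%:Z - 2%:Z = d%:Z - 1)//; lia.
Qed.

Lemma sum_row_up k i (phi : nat -> nat -> R) n : (0 < k)%N ->
  \sum_(0 <= l < n + k) \sum_(j < lev M0 M1 l) P (@St M0 M1 k.+1 i) (St j) * phi l j
  = \sum_(0 <= d < n) \sum_(j < M1) a d i j * phi (k + d)%N j.
Proof.
move=> k0; rewrite (@big_cat_nat _ _ _ k)//=; last exact: leq_addl.
rewrite [X in X + _]big1_seq ?add0r; last first.
  move=> l; rewrite mem_index_iota => /andP[_ /andP[_ lk]].
  by rewrite big1// => j _; rewrite mg1_mx_skip ?mul0r.
rewrite -{1}[k]add0n big_addn addnK; apply: eq_bigr => d _.
rewrite (@row_up _ k d)//; [|by rewrite addnC|by rewrite addn_gt0 k0 orbT].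
by rewrite addnC.
Qed.

Lemma sum_blkA_le1 i n : \sum_(0 <= d < n) \sum_(j < M1) a d i j <= 1.
Proof.
have -> : \sum_(0 <= d < n) \sum_(j < M1) a d i j
    = \sum_(x <- levels n.+1) P (@St M0 M1 2 i) x.
  rewrite sum_levels -addn1; transitivity (\sum_(0 <= d < n) \sum_(j < M1) a d i j * 1).
    by apply: eq_bigr => d _; apply: eq_bigr => j _; rewrite mulr1.
  rewrite -(@sum_row_up 1 i (fun _ _ => 1))//.
  by apply: eq_bigr => l _; apply: eq_bigr => j _; rewrite mulr1.
have [p0 sp <-] := stochastic_prob hP (@St M0 M1 2 i).
exact: rsum_ge_fin (uniq_levels _) p0 sp.
Qed.

Lemma sumEFin_rowA i n :
  (\sum_(0 <= j < n) ((j%:R - 1) * (blkA X (j%:Z - 1) *m ones R M1) i ord0)%:E)%E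
  = (\sum_(0 <= d < n) \sum_(j < M1) a d i j * (d%:R - 1))%:E.
Proof.
rewrite sumEFin; congr _%:E; apply: eq_bigr => d _.
rewrite mxE mulr_sumr; apply: eq_bigr => j _.
by rewrite [ones _ _ _ _]mxE mulr1 mulrC.
Qed.

(** Only the term [d = 0], with weight [-1], can be negative. From there on the partial sums
    increase, so the series has a limit in the extended reals, and this limit is above [-oo]. *)
Lemma meanA_sup i :
  meanA X i = ereal_sup (range (fun n =>
    (\sum_(0 <= d < n.+1) \sum_(j < M1) a d i j * (d%:R - 1))%:E)).
Proof.
rewrite /meanA (funext (sumEFin_rowA i)); apply/cvg_lim => //.
rewrite -cvg_shiftS; apply: ereal_nondecreasing_cvgn.
apply/nondecreasing_seqP => n; rewrite lee_fin [leRHS]big_nat_recr//= lerDl.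
by apply: sumr_ge0 => j _; rewrite mulr_ge0 ?blkA_ge0// subr_ge0 ler1n.
Qed.

Lemma meanA_gtNy i : (-oo < meanA X i)%E.
Proof.
rewrite meanA_sup; apply: (@lt_le_trans _ _
  (\sum_(0 <= d < 1) \sum_(j < M1) a d i j * (d%:R - 1))%:E); first exact: ltNyr.
by apply: ereal_sup_ubound; exists 0%N.
Qed.

(** Write [d] as [(d - 1) + 1]: the finite mean bounds the first part and the mass of a row bounds
    the second. *)
Lemma sum_blkA_bound i : (meanA X i < +oo)%E ->
  exists C : R, forall n, \sum_(0 <= d < n) \sum_(j < M1) a d i j * d%:R <= C.
Proof.
move=> hi; have fm : meanA X i \is a fin_num by rewrite fin_numElt meanA_gtNy.
exists (fine (meanA X i) + 1) => n.
apply: (@le_trans _ _ (\sum_(0 <= d < n.+1) \sum_(j < M1) a d i j * d%:R)).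
  rewrite big_nat_recr//= lerDl; apply: sumr_ge0 => j _.
  by rewrite mulr_ge0 ?blkA_ge0.
have -> : \sum_(0 <= d < n.+1) \sum_(j < M1) a d i j * d%:R =
  \sum_(0 <= d < n.+1) \sum_(j < M1) a d i j * (d%:R - 1) +
  \sum_(0 <= d < n.+1) \sum_(j < M1) a d i j.
  rewrite -big_split/=; apply: eq_bigr => d _; rewrite -big_split/=.
  by apply: eq_bigr => j _; rewrite mulrBr mulr1 subrK.
apply: lerD; last exact: sum_blkA_le1.
by rewrite -lee_fin fineK// meanA_sup; apply: ereal_sup_ubound; exists n.
Qed.

Lemma row_momentP : (forall i, (meanA X i < +oo)%E) ->
  (forall i, (meanB X i < +oo)%E) -> row_moment.
Proof.
move=> hA hB.
have nrm k (i : 'I_(lev M0 M1 k)) l (j : 'I_(lev M0 M1 l)) :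
    `|P (St i) (St j) * (lvl (St j))%:R| = P (St i) (St j) * l%:R.
  by rewrite ger0_norm// mulr_ge0// mg1_mx_ge0.
case=> -[|k] i.
  apply: (@rsummable_levels _ _ _ _ (fine (meanB X i))) => n.
  under eq_bigr do under eq_bigr do rewrite nrm.
  have t0 l : (0 <= (l%:R * (blkB X l *m ones R _) i ord0)%:E)%E.
    rewrite lee_fin mulr_ge0// mxE sumr_ge0// => j _.
    by rewrite [ones _ _ _ _]mxE mulr1; exact: (mg1_mx_ge0 (@St M0 M1 0 i) (St j)).
  have m0 : (0 <= meanB X i)%E by rewrite /meanB; apply: nneseries_ge0 => l _ _.
  have fB : meanB X i \is a fin_num by rewrite ge0_fin_numE.
  rewrite -lee_fin fineK//.
  case: n => [|n]; first by rewrite big_nil.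
  rewrite big_ltn// [X in X + _]big1 ?add0r; last by move=> j _; rewrite mulr0.
  rewrite /meanB; apply: le_trans (nneseries_lim_ge n.+1 _) => //.
  rewrite -sumEFin; apply: lee_sum => l _; rewrite lee_fin mxE mulr_sumr.
  apply: ler_sum => j _; rewrite [ones _ _ _ _]mxE mulr1 mulrC.
  exact: lexx.
have [C hC] := sum_blkA_bound (hA i).
apply: (@rsummable_levels _ _ _ _ (k%:R + C)) => n.
under eq_bigr do under eq_bigr do rewrite nrm.
have F0 l : 0 <= \sum_(j < lev M0 M1 l) P (@St M0 M1 k.+1 i) (St j) * l%:R.
  by apply: sumr_ge0 => j _; rewrite mulr_ge0// mg1_mx_ge0.
(* From level 1 the step to level 0 falls outside the pattern of [sum_row_up], but there the weight
   [l] is 0. *)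
have [k0|k0] := posnP k.
  subst k; rewrite add0r; apply: le_trans (hC n).
  apply: ler_sum => -[|l] _.
    by rewrite !big1// => j _; rewrite mulr0.
  by have -> := @row_up l.+1 0 l.+1 i (fun l _ => l%:R) erefl erefl.
apply: (@le_trans _ _ (\sum_(0 <= l < n + k)
    \sum_(j < lev M0 M1 l) P (@St M0 M1 k.+1 i) (St j) * l%:R)).
  rewrite [leRHS](@big_cat_nat _ _ _ n)//=; last exact: leq_addr.
  by rewrite lerDl; apply: sumr_ge0 => l _; exact: F0.
rewrite (@sum_row_up k i (fun l _ => l%:R))//.
have -> : \sum_(0 <= d < n) \sum_(j < M1) a d i j * (k + d)%:R
  = k%:R * (\sum_(0 <= d < n) \sum_(j < M1) a d i j)
    + \sum_(0 <= d < n) \sum_(j < M1) a d i j * d%:R.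
  rewrite mulr_sumr -big_split/=; apply: eq_bigr => d _.
  rewrite mulr_sumr -big_split/=; apply: eq_bigr => j _.
  by rewrite natrD mulrDr [k%:R * _]mulrC.
by rewrite lerD// ler_piMr// sum_blkA_le1.
Qed.

Lemma cvg_blkA i j : series (fun d => a d i j) @ \oo --> sumA X i j.
Proof.
have := @cvg_phase _ _ _ _ 0 j (rsummable_row (@St M0 M1 2 i)).
have -> : (fun l => P (@St M0 M1 2 i) (@St M0 M1 (0 + l).+1 j)) = (fun d => a d i j).
  apply/funext => l; transitivity (blkA X ((0 + l).+1%:Z - 2%:Z) i j).
    by rewrite (mg1_mxE X 1).
  by congr (blkA X _ i j); lia.
by move=> h; rewrite /sumA /mx_series mxE (cvg_lim _ h).
Qed.

Lemma cvg_row_sum i : (\sum_j sumA X i j = 1) ->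
  (fun n => \sum_(0 <= d < n) \sum_(j < M1) a d i j) @ \oo --> (1 : R).
Proof.
move=> <-; under eq_fun do rewrite exchange_big/=.
by apply: cvg_big => [|j _]; [exact: add_continuous|exact: cvg_blkA].
Qed.

Lemma cvg_meanA i : row_moment -> (meanA X i < +oo)%E ->
  (fun n => \sum_(0 <= d < n) \sum_(j < M1) a d i j * (d%:R - 1)) @ \oo
    --> fine (meanA X i).
Proof.
move=> hm hi.
have sf : rsummable (fun y => P (@St M0 M1 2 i) y * ((lvl y)%:R - 2)).
  have -> : (fun y => P (@St M0 M1 2 i) y * ((lvl y)%:R - 2)) =
      (fun y => P (@St M0 M1 2 i) y * (lvl y)%:R - P (@St M0 M1 2 i) y * 2).
    by apply/funext => y; rewrite mulrBr.
  by apply: rsummableB; [exact: hm|apply: rsummableZr; exact: rsummable_row].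
have := cvg_levels sf; rewrite -(cvg_shiftn 1)/=.
have -> : (fun n => \sum_(0 <= k < n + 1) \sum_(j < lev M0 M1 k)
    P (@St M0 M1 2 i) (St j) * ((lvl (St j))%:R - 2)) =
  (fun n => \sum_(0 <= d < n) \sum_(j < M1) a d i j * (d%:R - 1)).
  apply/funext => n; rewrite (@sum_row_up 1 i (fun l _ => l%:R - 2))//.
  apply: eq_bigr => d _; apply: eq_bigr => j _; congr (_ * _).
  by rewrite natrD; lra.
move=> h; suff -> : meanA X i = (rsum (fun y => P (@St M0 M1 2 i) y * ((lvl y)%:R - 2)))%:E by [].
rewrite /meanA (funext (sumEFin_rowA i)); apply/cvg_lim => //.
by apply: cvg_EFin; [exact: nearW|exact: h].
Qed.

(** Level 0 has phases of its own, to which [b] is unrelated, hence the value 0. From levels at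
    least 2 it is not reached in one step, so the drift there does not see this choice. *)
Definition lyap b x : R := if lvl x == 0%N then 0 else (lvl x)%:R + b (ph x).

Lemma lyap_ge0 b x : (forall j, 0 <= b j) -> 0 <= lyap b x.
Proof. by move=> b0; rewrite /lyap; case: ifP => // _; rewrite addr_ge0. Qed.

Lemma rsummable_lyap b B x : row_moment -> (forall j, 0 <= b j <= B) ->
  rsummable (fun y => P x y * lyap b y).
Proof.
move=> hm hb; have B0 : 0 <= B by have /andP[/le_trans] := hb 0%N; apply.
apply: (@rsummable_le _ _ _ (fun y => P x y * (lvl y)%:R + P x y * B)); last first.
  by apply: rsummableD; [exact: hm|apply: rsummableZr; exact: rsummable_row].
move=> y; have p0 := mg1_mx_ge0 x y; have /andP[b0 b1] := hb (ph y).
rewrite -mulrDr ger0_norm; last first.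
  by rewrite mulr_ge0// lyap_ge0// => j; have /andP[] := hb j.
rewrite ler_wpM2l// /lyap; case: ifP => _; first by rewrite addr_ge0.
by rewrite lerD2l.
Qed.

(** From level [k.+1] the chain moves to level [k + d = k.+1 + (d - 1)]; the three terms come from
    the total mass 1, the mean increment and the phase correction. *)
Lemma row_lyap k (i : 'I_M1) b B : (0 < k)%N -> row_moment -> (forall j, 0 <= b j <= B) ->
  (meanA X i < +oo)%E -> \sum_j sumA X i j = 1 ->
  rsum (fun y => P (@St M0 M1 k.+1 i) y * lyap b y)
  = k.+1%:R + fine (meanA X i) + \sum_j sumA X i j * b j.
Proof.
move=> k0 hm hb hi hs.
rewrite -(cvg_lim _ (cvg_levels (rsummable_lyap _ hm hb)))//.
apply/cvg_lim => //; rewrite -(cvg_shiftn k).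
have -> : (fun n => \sum_(0 <= l < n + k) \sum_(j < lev M0 M1 l)
    P (@St M0 M1 k.+1 i) (St j) * lyap b (St j)) =
  (fun n => k.+1%:R * (\sum_(0 <= d < n) \sum_(j < M1) a d i j)
    + (\sum_(0 <= d < n) \sum_(j < M1) a d i j * (d%:R - 1))
    + \sum_(j < M1) series (fun d => a d i j) n * b j).
  apply/funext => n.
  rewrite (@sum_row_up k i (fun l p => if l == 0%N then 0 else l%:R + b p))//.
  rewrite /series/=.
  under [X in _ = _ + _ + X]eq_bigr do rewrite mulr_suml.
  rewrite [X in _ = _ + _ + X]exchange_big/= mulr_sumr -!big_split/=.
  apply: eq_bigr => d _; rewrite mulr_sumr -!big_split/=; apply: eq_bigr => j _.
  rewrite addn_eq0 (gtn_eqF k0) natrD -natr1 /=; ring.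
apply: cvgD; first apply: cvgD.
- rewrite -[X in _ --> X]mulr1; apply: cvgM; [exact: cvg_cst|exact: cvg_row_sum].
- exact: cvg_meanA.
apply: cvg_big => [|j _]; first exact: add_continuous.
by apply: cvgM; [exact: cvg_blkA|exact: cvg_cst].
Qed.

End Rows.

(** * Level-increment truncation *)

Section Truncation.
Context {R : realType} {M0 M1 : nat}.
Variables (X : mg1_blocks R M0 M1) (N : nat).
Hypothesis hP : stochastic (mg1_mx X).
Hypothesis N0 : (0 < N)%N.
Local Notation P := (mg1_mx X).
Local Notation Q := (mg1_mx (LI_trunc X N)).
Local Notation S := (mg1_state M0 M1).
Implicit Types (x y z : S) (phi : nat -> nat -> R).

(** The tail at [N.-1] collects exactly the increments that are at least [N]. As [N > 0], they are
    collected on a positive level, where the phases are those of [A]. *)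
Lemma LI_truncE x y : Q x y =
  if (lvl y < lvl x + N)%N then P x y
  else if lvl y == (lvl x + N)%N then
    rsum (fun z => if (lvl x + N <= lvl z)%N && (ph z == ph y) then P x z else 0)
  else 0.
Proof.
case: x y => [[|k] i] [[|l] j]; rewrite /lvl /=.
- by rewrite N0.
- rewrite /mg1_mx/= add0n; case: ifP => // _; case: ifP => // [_|_]; last by rewrite mxE.
  rewrite (tailB_row hP); congr rsum; apply/funext => z.
  by rewrite prednK.
- by case: k i.
rewrite !mg1_mxE; case: ifP => kl; last first.
  by rewrite ifT//; lia.
rewrite /LI_trunc/=.
have -> : (l.+1%:Z - k.+1%:Z < N%:Z) = (l.+1 < k.+1 + N)%N by lia.
have -> : (l.+1%:Z - k.+1%:Z == N%:Z) = (l.+1 == k.+1 + N)%N by lia.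
case: ifP => // _; case: ifP => // [_|_]; last by rewrite mxE.
rewrite (tailA_row hP k); congr rsum; apply/funext => z.
by rewrite -addnS prednK.
Qed.

(* A row of the truncation is the image of the original row under
   [(l, j) |-> (min(l, k + N), j)]. *)
Lemma LI_trunc_rsum phi x :
  rsummable (fun z => P x z * phi (minn (lvl z) (lvl x + N)) (ph z)) ->
  rsummable (fun y => Q x y * phi (lvl y) (ph y)) /\
  rsum (fun y => Q x y * phi (lvl y) (ph y)) =
  rsum (fun z => P x z * phi (minn (lvl z) (lvl x + N)) (ph z)).
Proof.
move=> sh; have := @rsum_levels _ M0 M1 (lvl x + N).+1 (fun y => Q x y * phi (lvl y) (ph y)).
case=> [y yK|sQ ->]; first by rewrite LI_truncE ltnNge (ltnW yK)/= gtn_eqF ?mul0r.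
split=> //.
set K := (lvl x + N)%N; have K0 : (0 < K)%N by rewrite addn_gt0 N0 orbT.
pose h z := P x z * phi (minn (lvl z) K) (ph z).
pose lo z := if (lvl z < K)%N then h z else 0.
pose hi (j : 'I_M1) z := if (K <= lvl z)%N && (ph z == j) then P x z else 0.
have shi j : rsummable (hi j).
  apply: (rsummable_le _ (rsummable_row hP x)) => z; rewrite /hi.
  by case: ifP => _; rewrite ?normr0 ?ger0_norm ?mg1_mx_ge0.
have -> : rsum (fun z => P x z * phi (minn (lvl z) (lvl x + N)) (ph z))
    = rsum (fun z => lo z + \sum_(j < M1) hi j z * phi K j).
  congr rsum; apply/funext => z; rewrite /lo -/K -/(h z) /hi.
  case: ltnP => Kz /=.
    by rewrite big1 ?addr0// => j _; rewrite mul0r.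
  rewrite add0r /h (minn_idPr Kz) -(sum_ph (fun j => P x z * phi K j)); last exact: leq_trans Kz.
  by apply: eq_bigr => j _; case: ifP => _; rewrite ?mul0r.
have [|slo elo] := @rsum_levels _ _ _ K lo.
  by move=> z Kz; rewrite /lo ltnNge Kz.
rewrite rsumD//; last by apply: rsummable_sum => j; exact: rsummableZr.
rewrite rsum_sum; last by move=> j; exact: rsummableZr.
rewrite elo big_nat_recr//=; congr (_ + _).
  apply: eq_big_nat => l /andP[_ lK]; apply: eq_bigr => j _.
  have lE : lvl (St j) = l by [].
  by rewrite LI_truncE /lo /h -/K lE lK (minn_idPl (ltnW lK)).
have -> : \sum_(j < M1) rsum (fun z => hi j z * phi K j) = \sum_(j < M1) rsum (hi j) * phi K j.
  by apply: eq_bigr => j _; rewrite rsumZr.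
(* The type ['I_(lev M0 M1 K)] reduces to ['I_M1] only for a successor, so [K] is generalised to a
   variable that can be destructed. *)
have key l : l = K -> \sum_(j < lev M0 M1 l) Q x (St j) * phi l j
    = \sum_(j < M1) rsum (hi j) * phi K j.
  case: l => [e|l e]; first by rewrite -e in K0.
  rewrite -[X in _ = \sum_(j < M1) _ * phi X _]e; apply: eq_bigr => j _; congr (_ * _).
  have lE : lvl (@St M0 M1 l.+1 j) = K by exact: e.
  by rewrite LI_truncE -/K lE ltnn eqxx.
exact: (key K).
Qed.

Lemma LI_trunc_stochastic : stochastic Q.
Proof.
have sP x : rsummable (fun z => P x z * (fun _ _ => 1) (minn (lvl z) (lvl x + N)) (ph z)).
  by apply: rsummableZr; exact: rsummable_row.
have Q0 x y : 0 <= Q x y.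
  rewrite LI_truncE; case: ifP => _; first exact: mg1_mx_ge0.
  case: ifP => // _; apply: rsum_ge0 => z; case: ifP => // _; exact: mg1_mx_ge0.
split=> // x; have [] := @LI_trunc_rsum (fun _ _ => 1) x (sP x).
have -> : (fun y => Q x y * 1) = Q x by apply/funext => y; rewrite mulr1.
have -> : (fun y => P x y * 1) = P x by apply/funext => y; rewrite mulr1.
by move=> sQ e; rewrite rsumE// e; case: (stochastic_prob hP x) => _ _ ->.
Qed.

(** Capping the level at [lvl x + N] lowers it by the truncated difference [lvl y - (lvl x + N)]. A
    positive level stays positive under the cap, so neither the phase correction nor the special
    value on level 0 is affected. *)
Lemma LI_trunc_lyap b B x : row_moment X -> (forall j, 0 <= b j <= B) ->
  rsummable (fun y => Q x y * lyap b y) /\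
  rsum (fun y => Q x y * lyap b y) =
  rsum (fun y => P x y * lyap b y) - overshoot X x N.
Proof.
move=> hm hb.
pose phi l p := if l == 0%N then 0 else l%:R + b p : R.
have phile y : phi (minn (lvl y) (lvl x + N)) (ph y)
    = lyap b y - (lvl y - (lvl x + N))%N%:R.
  rewrite /phi /lyap; have [y0|y0] := posnP (lvl y).
    by rewrite y0 min0n eqxx sub0n subr0.
  rewrite gtn_eqF/=; last by rewrite leq_min y0 addn_gt0 N0 orbT.
  case: (leqP (lvl y) (lvl x + N)) => h.
    by rewrite (eqP (_ : lvl y - (lvl x + N) == 0)%N) ?subr0.
  by rewrite natrB ?(ltnW h)//; lra.
have sl := rsummable_lyap hP x hm hb.
have so : rsummable (fun y => P x y * (lvl y - (lvl x + N))%N%:R).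
  apply: (rsummable_le _ (hm x)) => y; rewrite ger0_norm ?mulr_ge0 ?mg1_mx_ge0//.
  by rewrite ler_wpM2l ?mg1_mx_ge0// ler_nat leq_subr.
have e : (fun y => P x y * phi (minn (lvl y) (lvl x + N)) (ph y)) =
    (fun y => P x y * lyap b y - P x y * (lvl y - (lvl x + N))%N%:R).
  by apply/funext => y; rewrite phile mulrBr.
have [|sQ eQ] := @LI_trunc_rsum phi x; first by rewrite e; exact: rsummableB.
by split=> //; rewrite [LHS]eQ e rsumB.
Qed.

(** Below level [lvl x + N] the two rows agree, and from there upwards they carry the same mass, at
    most twice which is displaced. That mass is a difference of consecutive overshoots, because
    [(u - v)^+ - (u - v - 1)^+] is the indicator of [v < u]. *)
Lemma LI_trunc_dist (w : S -> R) (B : R) x : row_moment X -> (forall y, `|w y| <= B) ->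
  `|rsum (fun y => Q x y * w y) - rsum (fun y => P x y * w y)|
  <= B * 2 * (overshoot X x N.-1 - overshoot X x N).
Proof.
move=> hm wB.
have B0 : 0 <= B := le_trans (normr_ge0 _) (wB x).
have P0 y := mg1_mx_ge0 hP x y.
have pQ := stochastic_prob LI_trunc_stochastic x; have [Q0 sQ _] := pQ.
have pP := stochastic_prob hP x; have [_ sP _] := pP.
pose phi l (p : nat) : R := (lvl x + N <= l)%N%:R.
have sphi p : is_prob p -> rsummable (fun y : S => p y * phi (lvl y) (ph y)).
  move=> pp; apply: (rsummable_prob (C := 1) pp) => y.
  by rewrite /phi; case: leq; rewrite ?normr0 ?normr1.
have ephi : (fun y => P x y * phi (minn (lvl y) (lvl x + N)) (ph y))
    = (fun y => P x y * phi (lvl y) (ph y)).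
  by apply/funext => y; rewrite /phi leq_min leqnn andbT.
have [|sQphi eQphi] := @LI_trunc_rsum phi x; first by rewrite ephi; exact: sphi.
rewrite ephi in eQphi.
have so n : rsummable (fun y => P x y * (lvl y - (lvl x + n))%N%:R).
  apply: (rsummable_le _ (hm x)) => y; rewrite ger0_norm ?mulr_ge0//.
  by rewrite ler_wpM2l// ler_nat leq_subr.
have -> : overshoot X x N.-1 - overshoot X x N = rsum (fun y => P x y * phi (lvl y) (ph y)).
  rewrite /overshoot -rsumB//; congr rsum; apply/funext => y.
  rewrite -mulrBr; congr (_ * _); rewrite /phi.
  have -> : (lvl x + N = (lvl x + N.-1).+1)%N by rewrite -addnS prednK.
  move: (lvl y) (lvl x + N.-1)%N => u v; case: ltnP => h.
    have -> : (u - v = (u - v.+1).+1)%N by lia.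
    by rewrite -natr1 addrAC subrr add0r.
  have -> : (u - v = 0)%N by lia.
  have -> : (u - v.+1 = 0)%N by lia.
  by rewrite subrr.
rewrite -rsumB; [|exact: rsummable_prob pQ wB|exact: rsummable_prob pP wB].
have sd : rsummable (fun y => Q x y * w y - P x y * w y).
  by apply: rsummableB; [exact: rsummable_prob pQ wB|exact: rsummable_prob pP wB].
apply: (le_trans (rsum_norm sd)).
have -> : B * 2 * rsum (fun y => P x y * phi (lvl y) (ph y)) =
  rsum (fun y => B * (Q x y * phi (lvl y) (ph y) + P x y * phi (lvl y) (ph y))).
  rewrite rsumZ; last by apply: rsummableD => //; exact: sphi.
  by rewrite rsumD// ?eQphi; [lra|exact: sphi].
apply: ler_rsum; first exact: rsummable_norm.
  by apply: rsummableZ; apply: rsummableD => //; exact: sphi.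
move=> y; rewrite -mulrBl normrM mulrC -mulrDl /phi.
rewrite [in X in X <= _]LI_truncE; case: ltnP => h.
  by rewrite subrr normr0 mulr0 mulr0 mulr0.
rewrite mulr1 ler_pM//.
have := P0 y; have := Q0 y; rewrite LI_truncE ltnNge h /= => q0 p0.
by rewrite ler_norml; apply/andP; split; lra.
Qed.

End Truncation.

(** * The Lyapunov function *)

Section PoissonStationary.
Context {R : realType} {T : choiceType}.
Variable P : T -> T -> R.
Hypothesis hP : stochastic P.

(** Summing the Poisson equation against [mu] cancels its left-hand side, which forces the unknown
    constant to be [mu y / mu a]. *)
Lemma poisson_stationary mu a y : irreducible P -> stationary_distribution P mu ->
  exists (w : T -> R) (B : R), (forall x, `|w x| <= B) /\
    forall x, w x - rsum (fun z => P x z * w z)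
      = (x == y)%:R - mu y / mu a * (x == a)%:R.
Proof.
move=> irr hmu; have mu0 := stationary_gt0 hP irr hmu.
have [w [c [B [wB e]]]] := poisson_bounded hP (irr y a).
exists w, B; split=> // x; rewrite e; congr (_ - _ * _).
have pm := stationary_prob hmu.
have delta u : rsummable (fun x => mu x * (x == u)%:R) /\
    rsum (fun x => mu x * (x == u)%:R) = mu u.
  have [s E] := rsum_if u mu.
  have -> : (fun x => mu x * (x == u)%:R) = (fun x => if x == u then mu x else 0).
    by apply/funext => z; case: eqP => _; rewrite ?mulr1 ?mulr0.
  by split.
have [sy ey] := delta y; have [sa ea] := delta a.
have swB := rsummable_prob pm wB.
have PwB x' : `|rsum (fun z => P x' z * w z)| <= B.
  exact: rsum_prob_norm (stochastic_prob hP x') wB.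
have sPw := rsummable_prob pm PwB.
have h : rsum (fun x => mu x * (w x - rsum (fun z => P x z * w z)))
    = rsum (fun x => mu x * (x == y)%:R - c * (mu x * (x == a)%:R)).
  by congr rsum; apply/funext => z; rewrite e mulrBr mulrCA.
rewrite rsumB// in h; last exact: rsummableZ.
rewrite rsumZ// ey ea in h.
have h2 : rsum (fun x => mu x * (w x - rsum (fun z => P x z * w z))) = 0.
  have -> : (fun x => mu x * (w x - rsum (fun z => P x z * w z)))
    = (fun x => mu x * w x - mu x * rsum (fun z => P x z * w z)).
    by apply/funext => z; rewrite mulrBr.
  by rewrite rsumB// (rsum_stationary hP hmu wB) subrr.
rewrite h2 in h; have -> : mu y = c * mu a by apply/eqP; rewrite -subr_eq0 -h.
by rewrite mulfK// gt_eqF.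
Qed.

End PoissonStationary.

(** Superpose the solutions for the indicators of the states [y], with the centred values of [g] as
    weights. The terms at [a] add up to a multiple of the [m]-mean of these weights, which is 0. *)
Lemma poisson_finite {R : realType} {T : finType} (A : T -> T -> R) (m : T -> R) (a : T)
    (g : T -> R) : stochastic A -> irreducible A -> stationary_distribution A m ->
  exists b : T -> R, forall i, b i - \sum_j A i j * b j = g i - \sum_j m j * g j.
Proof.
move=> hA irr hm; have mu0 := stationary_gt0 hA irr hm.
have [_ _ em] := stationary_prob hm; rewrite (proj2 (rsum_fintype m)) in em.
have hw y : exists w : T -> R, forall x, w x - \sum_z A x z * w z
    = (x == y)%:R - m y / m a * (x == a)%:R.
  have [w [B [_ e]]] := poisson_stationary hA a y irr hm; exists w => x.
  by rewrite -e (proj2 (rsum_fintype _)).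
pose w y := projT1 (cid (hw y)); have ew y := projT2 (cid (hw y)).
pose g' y := g y - \sum_j m j * g j.
have gm : \sum_y g' y * m y = 0.
  under eq_bigr do rewrite mulrBl [g _ * _]mulrC.
  by rewrite sumrB -mulr_sumr em mulr1 subrr.
exists (fun i => \sum_y g' y * w y i) => i.
have -> : \sum_j A i j * (\sum_y g' y * w y j) = \sum_y g' y * (\sum_j A i j * w y j).
  under eq_bigr do rewrite mulr_sumr.
  rewrite exchange_big/=; apply: eq_bigr => y _; rewrite mulr_sumr.
  by apply: eq_bigr => j _; rewrite mulrCA.
rewrite -sumrB; under eq_bigr do rewrite -mulrBr ew mulrBr.
rewrite sumrB [X in _ - X](_ : _ = (\sum_y g' y * m y) * ((m a)^-1 * (i == a)%:R)); last first.
  by rewrite mulr_suml; apply: eq_bigr => y _; rewrite !mulrA.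
rewrite gm mul0r subr0 (bigD1 i)//= eqxx mulr1 big1 ?addr0// => y /negbTE.
by rewrite eq_sym => ->; rewrite mulr0.
Qed.

(** * Finiteness of the mean increments and the function of constant drift *)

Section Drift.
Context {R : realType} {M0 M1 : nat}.
Variables (X : mg1_blocks R M0 M1) (varpi : 'rV[R]_M1).
Hypothesis hP : stochastic (mg1_mx X).
Hypothesis w0 : forall i, 0 < varpi ord0 i.
Hypothesis hs : (drift X varpi < 0)%E.

(** All weights [varpi] are positive and no mean increment is [-oo], so a single infinite one would
    make the drift [+oo]. *)
Lemma meanA_lty i : (meanA X i < +oo)%E.
Proof.
rewrite ltey; apply/eqP => e; move: hs; rewrite /drift (bigD1 i)//= e.
rewrite gt0_muley ?lte_fin// addye ?ltNge ?leey//.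
apply: (big_ind (fun u : \bar R => u != -oo%E)) => //; first by move=> [u||] [v||].
move=> j _; have := meanA_gtNy hP j; case: (meanA X j) => [r|_|]//.
by rewrite gt0_muley ?lte_fin.
Qed.

Lemma drift_fine : fine (drift X varpi) = \sum_i varpi ord0 i * fine (meanA X i).
Proof.
rewrite /drift; have fm i : meanA X i \is a fin_num.
  by rewrite fin_numElt meanA_gtNy// meanA_lty.
under eq_bigr do rewrite -(fineK (fm _)) -EFinM.
by rewrite sumEFin.
Qed.

Lemma drift_fine_lt0 : fine (drift X varpi) < 0.
Proof.
move: hs; rewrite /drift; have fm i : meanA X i \is a fin_num.
  by rewrite fin_numElt meanA_gtNy// meanA_lty.
under eq_bigr do rewrite -(fineK (fm _)) -EFinM.
by rewrite sumEFin lte_fin.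
Qed.

(* [b] corrects the phase-dependence of the mean increments, so that the
   Lyapunov function has constant drift [sigma] on the levels [k >= 2]. *)
Lemma exists_lyap : (0 < M1)%N -> row_moment X ->
  stochastic (fun i j => sumA X i j) -> irreducible (fun i j => sumA X i j) ->
  stationary_distribution (fun i j => sumA X i j) (fun i => varpi ord0 i) ->
  exists (b : nat -> R) (B : R), (forall j, 0 <= b j <= B) /\
    forall x, (1 < lvl x)%N ->
      rsum (fun y => mg1_mx X x y * lyap b y) - lyap b x = fine (drift X varpi).
Proof.
move=> hM1 hm hA irr hv.
have [b0 eb0] := poisson_finite (Ordinal hM1) (fun i => fine (meanA X i)) hA irr hv.
have rs i : \sum_j sumA X i j = 1.
  by have [_ _] := stochastic_prob hA i; rewrite (proj2 (rsum_fintype _)).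
pose C := \sum_i `|b0 i|.
have b0C i : `|b0 i| <= C by rewrite /C (bigD1 i)//= lerDl sumr_ge0.
(* The shift by [C] makes the correction nonnegative; the rows of [A] sum to 1, so it cancels in the
   Poisson equation. *)
pose b n : R := if insub n is Some i then b0 i + C else 0.
have bE (i : 'I_M1) : b i = b0 i + C by rewrite /b valK.
have bB n : 0 <= b n <= C * 2.
  have C0 : 0 <= C by apply: sumr_ge0.
  rewrite /b; case: insubP => [i _ _|_]; last by rewrite lexx mulr_ge0.
  by have := b0C i; rewrite ler_norml => /andP[? ?]; apply/andP; split; lra.
exists b, (C * 2); split=> // -[[|[|k]] i]// _.
rewrite -/(@St M0 M1 k.+2 i) (row_lyap hP _ hm bB) ?meanA_lty//.
have -> : lyap b (@St M0 M1 k.+2 i) = k.+2%:R + (b0 i + C) by rewrite -bE.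
under eq_bigr do rewrite bE mulrDr.
rewrite big_split/= -mulr_suml rs drift_fine.
have := eb0 i.
set u := \sum_j _ * b0 j; set v := \sum_j _ * fine _.
by lra.
Qed.

End Drift.

(** * Asymptotics *)

Section Limit.
Context {R : realType} {M0 M1 : nat}.
Variable X : mg1_blocks R M0 M1.
Local Notation S := (mg1_state M0 M1).
Local Notation P := (mg1_mx X).
Local Notation Q N := (mg1_mx (LI_trunc X N)).
Hypothesis hM0 : (0 < M0)%N.
Hypothesis hP : stochastic P.
Hypothesis irr : irreducible P.
Hypothesis hm : row_moment X.
Variables (b : nat -> R) (B sigma : R).
Hypothesis hb : forall j, 0 <= b j <= B.
Hypothesis hV : forall x, (1 < lvl x)%N ->
  rsum (fun y => P x y * lyap b y) - lyap b x = sigma.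
Hypothesis sigma0 : sigma < 0.
Variables (pi : S -> R) (piN : nat -> S -> R).
Hypothesis hpi : stationary_distribution P pi.
Hypothesis hpiN : forall N, (0 < N)%N -> stationary_distribution (Q N) (piN N).
Variable Fb : nat -> R.
Hypothesis Fb_gt0 : forall n, 0 < Fb n.
Hypothesis Fb_cvg0 : Fb @ \oo --> (0 : R).
Hypothesis Fb_ratio : forall m, (fun n => Fb (n + m)%N / Fb n) @ \oo --> (1 : R).
Variable c : S -> R.
Hypothesis hc : forall x, (fun n => overshoot X x n.+1 / Fb n) @ \oo --> c x.

Let a : S := @St M0 M1 0 (Ordinal hM0).

(* The overshoot depends on the state only through its phase and whether its
   level is 0, so suprema over states reduce to sums over levels 0 and 1. *)
Lemma overshoot_repr x : exists2 z, z \in @levels M0 M1 2 &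
  forall n, overshoot X x n.+1 = overshoot X z n.+1.
Proof.
case: x => -[|k] i; first by exists (@St M0 M1 0 i); rewrite ?mem_levels.
exists (@St M0 M1 1 i); rewrite ?mem_levels// => n.
by rewrite -(tail2A_overshoot hP 0) // -(tail2A_overshoot hP k).
Qed.

Lemma overshoot_ge0 x n : 0 <= overshoot X x n.
Proof. by apply: rsum_ge0 => y; rewrite mulr_ge0 ?mg1_mx_ge0. Qed.

Lemma overshoot_ndS x n : overshoot X x n.+1 <= overshoot X x n.
Proof.
have so k : rsummable (fun y => P x y * (lvl y - (lvl x + k))%N%:R).
  apply: (rsummable_le _ (hm x)) => y; rewrite ger0_norm ?mulr_ge0 ?mg1_mx_ge0//.
  by rewrite ler_wpM2l ?mg1_mx_ge0// ler_nat leq_subr.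
apply: ler_rsum => // y; rewrite ler_wpM2l ?mg1_mx_ge0// ler_nat addnS.
by apply: leq_sub2l; exact: leqnSn.
Qed.

(** Throughout, [N = n.+2]: both thresholds that occur, [N] and [N - 1], are then successors, the
    form in which [hc] and [overshoot_repr] apply. *)
Let ov n x := overshoot X x n.+2 / Fb n.+2.
Let gap n x := (overshoot X x n.+1 - overshoot X x n.+2) / Fb n.+2.
Let Gap n := \sum_(z <- @levels M0 M1 2) gap n z.

(** The assumption normalises threshold [n.+1] by [Fb n]; long-tailedness allows [Fb n.+2] in its
    place. *)
Lemma cvg_overshoot0 x : (fun n => overshoot X x n.+1 / Fb n.+2) @ \oo --> c x.
Proof.
have -> : (fun n => overshoot X x n.+1 / Fb n.+2)
    = (fun n => overshoot X x n.+1 / Fb n * (Fb (n + 2)%N / Fb n)^-1).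
  apply/funext => n; rewrite addn2 invf_div mulrA divfK//.
  by rewrite gt_eqF.
have -> : c x = c x * 1^-1 by rewrite invr1 mulr1.
by apply: cvgM; [exact: hc|apply: cvgV; [exact: oner_neq0|exact: Fb_ratio]].
Qed.

Lemma cvg_overshoot1 x : ov ^~ x @ \oo --> c x.
Proof.
have -> : ov ^~ x = (fun n => overshoot X x n.+2 / Fb n.+1 * (Fb (n.+1 + 1)%N / Fb n.+1)^-1).
  apply/funext => n; rewrite /ov addn1 invf_div mulrA divfK//.
  by rewrite gt_eqF.
have -> : c x = c x * 1^-1 by rewrite invr1 mulr1.
apply: cvgM; first by rewrite (cvg_shiftS (fun n => overshoot X x n.+1 / Fb n)); exact: hc.
apply: cvgV; first exact: oner_neq0.
by rewrite (cvg_shiftS (fun n => Fb (n + 1)%N / Fb n)); exact: Fb_ratio.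
Qed.

(** A gap is a simple tail, that is, a difference of two consecutive double tails, and under the
    common normalisation these have the same limit. *)
Lemma cvg_gap x : gap ^~ x @ \oo --> (0 : R).
Proof.
have -> : gap ^~ x = (fun n => overshoot X x n.+1 / Fb n.+2 - ov n x).
  by apply/funext => n; rewrite /gap mulrBl.
by rewrite -(subrr (c x)); apply: cvgB; [exact: cvg_overshoot0|exact: cvg_overshoot1].
Qed.

Lemma gap_ge0 n x : 0 <= gap n x.
Proof. by rewrite /gap divr_ge0 ?(ltW (Fb_gt0 _))// subr_ge0 overshoot_ndS. Qed.

Lemma gap_le n x : gap n x <= Gap n.
Proof.
have [z zl e] := overshoot_repr x.
have -> : gap n x = gap n z by rewrite /gap !e.
rewrite /Gap (bigD1_seq z)//= ?uniq_levels// lerDl.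
by apply: sumr_ge0 => ? _; exact: gap_ge0.
Qed.

Lemma cvg_Gap : Gap @ \oo --> (0 : R).
Proof.
have -> : (0 : R) = \sum_(z <- @levels M0 M1 2) (0 : R) by rewrite big1_eq.
by apply: cvg_big => [|z _]; [exact: add_continuous|exact: cvg_gap].
Qed.

Lemma ov_ge0 n x : 0 <= ov n x.
Proof. by rewrite /ov divr_ge0 ?overshoot_ge0// ltW. Qed.

(** Uniformity in the state is what allows averaging against the varying distributions [mu n]. *)
Lemma ov_bound : exists K : R, forall n x, `|ov n x| <= K.
Proof.
pose O n := \sum_(z <- @levels M0 M1 2) ov n z.
have cO : O @ \oo --> \sum_(z <- @levels M0 M1 2) c z.
  by apply: cvg_big => [|z _]; [exact: add_continuous|exact: cvg_overshoot1].
have [|K [_ hK]] := cvg_seq_bounded (a := O); first by apply/cvg_ex; eexists; exact: cO.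
exists (K + 1) => n x; have [z zl e] := overshoot_repr x.
have -> : ov n x = ov n z by rewrite /ov e.
have := hK (K + 1) _ n I; rewrite ltrDl ltr01 => /(_ isT); apply: le_trans.
rewrite (ger0_norm (ov_ge0 _ _)) ger0_norm; last by apply: sumr_ge0 => ? _; exact: ov_ge0.
rewrite /O (bigD1_seq z)//= ?uniq_levels// lerDl.
by apply: sumr_ge0 => ? _; exact: ov_ge0.
Qed.

Let mu n := piN n.+2.
Let hmu n : stationary_distribution (Q n.+2) (mu n). Proof. exact: hpiN. Qed.
Let hQ n : stochastic (Q n.+2). Proof. exact: LI_trunc_stochastic. Qed.
Let pmu n : is_prob (mu n). Proof. exact: stationary_prob (hmu n). Qed.
Let ppi : is_prob pi. Proof. exact: stationary_prob hpi. Qed.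
Let rho n := mu n a / pi a.
Let err n y := (mu n y - pi y * rho n) / Fb n.+2.

(* With [w] a bounded solution of [(I - P) w = 1_y - (pi y / pi a) 1_a], one has
   [mu (I - P) w = mu (Q - P) w], which is of the order of the gaps. *)
Lemma cvg_err y : err ^~ y @ \oo --> (0 : R).
Proof.
have [w [C [wC e]]] := poisson_stationary hP a y irr hpi.
have bnd n : `|err n y| <= C * 2 * Gap n.
  have id1 : mu n y - pi y * rho n =
      rsum (fun x => mu n x * (rsum (fun z => Q n.+2 x z * w z) - rsum (fun z => P x z * w z))).
    have PwC x : `|rsum (fun z => P x z * w z)| <= C.
      exact: rsum_prob_norm (stochastic_prob hP x) wC.
    have QwC x : `|rsum (fun z => Q n.+2 x z * w z)| <= C.
      exact: rsum_prob_norm (stochastic_prob (hQ n) x) wC.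
    have s1 := rsummable_prob (pmu n) PwC; have s2 := rsummable_prob (pmu n) QwC.
    have s3 := rsummable_prob (pmu n) wC.
    have -> : (fun x => mu n x * (rsum (fun z => Q n.+2 x z * w z) - rsum (fun z => P x z * w z)))
      = (fun x => mu n x * rsum (fun z => Q n.+2 x z * w z)
                  - mu n x * rsum (fun z => P x z * w z)).
      by apply/funext => x; rewrite mulrBr.
    rewrite rsumB// (rsum_stationary (hQ n) (hmu n) wC) -rsumB//.
    have [sy ey] := rsum_if y (mu n); have [sa ea] := rsum_if a (mu n).
    have -> : (fun x => mu n x * w x - mu n x * rsum (fun z => P x z * w z)) =
      (fun x => (if x == y then mu n x else 0) - pi y / pi a * (if x == a then mu n x else 0)).
      apply/funext => x; rewrite -mulrBr e mulrBr.
      by case: (x == y); case: (x == a); rewrite ?mulr1 ?mulr0// mulrC.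
    rewrite rsumB//; last exact: rsummableZ.
    by rewrite rsumZ// ey ea /rho; congr (_ - _); rewrite mulrCA mulrC.
  rewrite /err id1 normrM normfV (gtr0_norm (Fb_gt0 _)) ler_pdivrMr//.
  apply: rsum_prob_norm => // x.
  apply: (le_trans (LI_trunc_dist hP _ x hm wC)) => //.
  have C0 : 0 <= C := le_trans (normr_ge0 _) (wC x).
  rewrite -!mulrA ler_wpM2l// ler_wpM2l//= -ler_pdivrMr//.
  exact: gap_le.
apply: norm_cvg0; apply: (@squeeze_cvgr _ _ _ _ (fun=> 0) (fun n => C * 2 * Gap n)).
- by apply: nearW => n; rewrite normr_ge0 bnd.
- exact: cvg_cst.
- by rewrite -(mulr0 (C * 2)); apply: cvgM; [exact: cvg_cst|exact: cvg_Gap].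
Qed.

(** * Drift identities for the original and the truncated chain *)

Let V : S -> R := lyap b.
Let f0 x := rsum (fun y => P x y * V y) - V x - sigma.
Let L2 : seq S := levels 2.

Let f0_hi x : x \notin L2 -> f0 x = 0.
Proof. by rewrite mem_levels -leqNgt => h; rewrite /f0 hV// subrr. Qed.

Let K0 : R := \sum_(x <- L2) `|f0 x|.

Let f0K x : `|f0 x| <= K0.
Proof.
have [xl|xl] := boolP (x \in L2); last by rewrite f0_hi// normr0 sumr_ge0.
by rewrite /K0 (bigD1_seq x)//= ?uniq_levels// lerDl sumr_ge0.
Qed.

Let V_ge0 x : 0 <= V x.
Proof. by apply: lyap_ge0 => j; have /andP[] := hb j. Qed.

(** Both matrices are skip-free downwards: one step lowers the level by at most 1 and the phase
    correction by at most [B]. *)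
Let V_le (Y : mg1_blocks R M0 M1) x y : mg1_mx Y x y != 0 -> V x - (B + 1) <= V y.
Proof.
move=> h; have hl : (lvl x <= (lvl y).+1)%N.
  by rewrite leqNgt; apply: contra h => h; rewrite mg1_mx_skip.
have /andP[b0 bB] := hb (ph x); have /andP[b0' _] := hb (ph y).
have V1 : V x <= (lvl x)%:R + B.
  rewrite /V /lyap; case: ifP => _; last by rewrite lerD2l.
  by rewrite addr_ge0// (le_trans b0 bB).
have V2 : (lvl y)%:R <= V y.
  by rewrite /V /lyap; case: eqP => [->//|_]; rewrite lerDl.
by move: hl; rewrite -(ler_nat R) -natr1; lra.
Qed.

(** One constant for both requirements of [rsum_drift]: [K0] bounds the upward drift, as
    [sigma < 0], and [B + 1] bounds a downward step. *)
Let K1 : R := K0 + (B + 1).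

Let B_ge0 : 0 <= B. Proof. by have /andP[/le_trans] := hb 0%N; apply. Qed.
Let K0_ge0 : 0 <= K0. Proof. exact: sumr_ge0. Qed.

Let rsum_pi_f0 : sigma + \sum_(z <- L2) pi z * f0 z = 0.
Proof.
have [||x|x|x y|_ e] := rsum_drift hP (V := V) (C := K1) hpi.
- by rewrite /K1; have := B_ge0; have := K0_ge0; lra.
- exact: V_ge0.
- by have := rsummable_lyap hP x hm hb.
- have := f0K x; rewrite ler_norml => /andP[_]; rewrite /f0 /K1.
  by have := B_ge0; have := sigma0; lra.
- move=> pxy; apply: le_trans (V_le (Y := X) (x := x) (y := y) _); last by rewrite gt_eqF.
  by rewrite /K1; have := K0_ge0; lra.
have [sf <-] := @rsum_fin _ _ (fun z => pi z * f0 z) _ (uniq_levels 2)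
  (fun z zl => etrans (congr1 _ (f0_hi zl)) (mulr0 _)).
rewrite -[X in X + _](rsum_prob_cst sigma ppi) -rsumD//; last first.
  by case: ppi => _ sp _; exact: rsummableZr.
rewrite -[RHS]e; congr rsum; apply/funext => z; rewrite -mulrDr; congr (_ * _).
by rewrite /f0; lra.
Qed.

(** Under the truncated chain the drift of [V] is [sigma + f0] minus the overshoot, and its mean
    under [mu n] is 0. *)
Let rsum_mu_f0 n : sigma + \sum_(z <- L2) mu n z * f0 z
  = rsum (fun x => mu n x * ov n x) * Fb n.+2.
Proof.
have Qe x := LI_trunc_lyap hP (ltn0Sn n.+1) x hm hb.
have [||x|x|x y|se e] := rsum_drift (hQ n) (V := V) (C := K1) (hmu n).
- by rewrite /K1; have := B_ge0; have := K0_ge0; lra.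
- exact: V_ge0.
- by case: (Qe x).
- rewrite (proj2 (Qe x)); have := overshoot_ge0 x n.+2.
  have := f0K x; rewrite ler_norml => /andP[_]; rewrite /f0 /K1 -/V.
  by have := B_ge0; have := sigma0; lra.
- move=> pxy; apply: le_trans (V_le (Y := LI_trunc X n.+2) (x := x) (y := y) _).
  2: by rewrite gt_eqF.
  by rewrite /K1; have := K0_ge0; lra.
have [sf <-] := @rsum_fin _ _ (fun z => mu n z * f0 z) _ (uniq_levels 2)
  (fun z zl => etrans (congr1 _ (f0_hi zl)) (mulr0 _)).
have [K hK] := ov_bound; have so := rsummable_prob (pmu n) (hK n).
rewrite -[X in X + _](rsum_prob_cst sigma (pmu n)) -rsumD//; last first.
  by case: (pmu n) => _ sp _; exact: rsummableZr.
rewrite -rsumZr// -[LHS]subr0 -[X in _ - X]e -rsumB//; last first.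
  apply: rsummableD => //; by case: (pmu n) => _ sp _; exact: rsummableZr.
congr rsum; apply/funext => z; rewrite (proj2 (Qe z)) -/V /ov /f0.
rewrite -mulrA divfK ?gt_eqF//; ring.
Qed.

(** Insert [mu n z = rho n * pi z + err n z * Fb n.+2] into the identity for [mu n] and eliminate
    the sum of [pi z * f0 z], which the identity for [pi] evaluates to [- sigma]. *)
Let rhoE n : (rho n - 1) / Fb n.+2 =
  (rsum (fun x => mu n x * ov n x) - \sum_(z <- L2) err n z * f0 z) / - sigma.
Proof.
have sn : sigma != 0 by rewrite lt_eqF.
have Fn : Fb n.+2 != 0 by rewrite gt_eqF.
have e : \sum_(z <- L2) mu n z * f0 z
    = (\sum_(z <- L2) err n z * f0 z) * Fb n.+2 + rho n * \sum_(z <- L2) pi z * f0 z.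
  rewrite mulr_suml mulr_sumr -big_split/=; apply: eq_bigr => z _.
  by rewrite /err mulrAC divfK//; ring.
have e1 := rsum_pi_f0; have e2 := rsum_mu_f0 n.
apply/eqP; rewrite eqr_div ?oppr_eq0//; apply/eqP.
move: e e1 e2; set u := \sum_(z <- L2) pi z * f0 z; set v := \sum_(z <- L2) mu n z * f0 z.
move=> e e1 e2; have eu : u = - sigma by lra.
rewrite e eu in e2.
by rewrite [RHS]mulrBl -e2; ring.
Qed.

Let cvg_err_sum : (fun n => \sum_(z <- L2) err n z * f0 z) @ \oo --> (0 : R).
Proof.
suff : (fun n => \sum_(z <- L2) err n z * f0 z) @ \oo --> \sum_(z <- L2) (0 : R).
  by rewrite big1_eq.
apply: cvg_big => [|z _].
  exact: add_continuous.
by rewrite -(mul0r (f0 z)); apply: cvgM; [exact: cvg_err|exact: cvg_cst].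
Qed.

Let Fb_cvg2 : (fun n => Fb n.+2) @ \oo --> (0 : R).
Proof. by rewrite (cvg_shiftS (fun n => Fb n.+1)) (cvg_shiftS Fb). Qed.

(** At this stage the averaged overshoot is only known to be bounded, and multiplied by the
    vanishing [Fb] this suffices. Its limit becomes accessible once [mu n] is known to converge. *)
Let cvg_rho : rho @ \oo --> (1 : R).
Proof.
have [K hK] := ov_bound.
have cA : (fun n => Fb n.+2 * rsum (fun x => mu n x * ov n x)) @ \oo --> (0 : R).
  apply: norm_cvg0; apply: (@squeeze_cvgr _ _ _ _ (fun=> 0) (fun n => Fb n.+2 * K)).
  - apply: nearW => n; rewrite normr_ge0 normrM (gtr0_norm (Fb_gt0 _)).
    rewrite ler_wpM2l ?(ltW (Fb_gt0 _))//.
    exact: rsum_prob_norm (pmu n) (hK n).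
  - exact: cvg_cst.
  - by rewrite -(mul0r K); apply: cvgM; [exact: Fb_cvg2|exact: cvg_cst].
have -> : rho = (fun n => 1 + (Fb n.+2 * rsum (fun x => mu n x * ov n x)
    - Fb n.+2 * \sum_(z <- L2) err n z * f0 z) / - sigma).
  apply/funext => n; rewrite -mulrBr -mulrA -rhoE mulrC divfK ?gt_eqF//.
  by rewrite addrC subrK.
suff : (fun n => 1 + (Fb n.+2 * rsum (fun x => mu n x * ov n x)
    - Fb n.+2 * \sum_(z <- L2) err n z * f0 z) / - sigma) @ \oo
    --> 1 + (0 - 0 * 0) / - sigma by rewrite mulr0 subr0 mul0r addr0.
apply: cvgD; first exact: cvg_cst.
apply: cvgM; last exact: cvg_cst.
apply: cvgB => //; apply: cvgM; [exact: Fb_cvg2|exact: cvg_err_sum].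
Qed.

Let cvg_mu z : mu ^~ z @ \oo --> pi z.
Proof.
have -> : mu ^~ z = (fun n => err n z * Fb n.+2 + pi z * rho n).
  by apply/funext => n; rewrite /err divfK ?gt_eqF// subrK.
suff : (fun n => err n z * Fb n.+2 + pi z * rho n) @ \oo --> 0 * 0 + pi z * 1.
  by rewrite mulr0 add0r mulr1.
apply: cvgD; first by apply: cvgM; [exact: cvg_err|exact: Fb_cvg2].
by apply: cvgM; [exact: cvg_cst|exact: cvg_rho].
Qed.

(** The error is [err], which vanishes, plus the relative change [rho - 1] common to all states; the
    limit of the latter is that of the averaged overshoot in [rhoE]. *)
Lemma cvg_LI_trunc y : (fun N => (piN N y - pi y) / Fb N) @ \oo
  --> rsum (fun x => pi x * c x) / - sigma * pi y.
Proof.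
rewrite -(cvg_shiftn 2).
have -> : (fun n => (piN (n + 2)%N y - pi y) / Fb (n + 2)%N) =
  (fun n => err n y + (rho n - 1) / Fb n.+2 * pi y).
  by apply/funext => n; rewrite addn2 /err /mu; ring.
have [K hK] := ov_bound.
suff : (fun n => err n y + (rho n - 1) / Fb n.+2 * pi y) @ \oo
    --> 0 + rsum (fun x => pi x * c x) / - sigma * pi y by rewrite add0r.
apply: cvgD; first exact: cvg_err.
apply: cvgM; last exact: cvg_cst.
rewrite (funext rhoE); apply: cvgM; last exact: cvg_cst.
rewrite -[rsum (fun x => pi x * c x)]subr0; apply: cvgB; last exact: cvg_err_sum.
exact: (cvg_rsum_prob ppi pmu cvg_mu hK cvg_overshoot1).
Qed.

End Limit.

(** * Identification of the constant and conclusion *)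

Lemma rsum_levels_split {R : realType} {M0 M1 : nat} (mu : mg1_state M0 M1 -> R)
    (cA : 'cV[R]_M1) (cB : 'cV[R]_M0) (c : mg1_state M0 M1 -> R) :
  rsummable mu ->
  (forall i, c (@St M0 M1 0 i) = cB i ord0) ->
  (forall k i, c (@St M0 M1 k.+1 i) = cA i ord0) ->
  rsum (fun x => mu x * c x) =
  (level_part mu 0%N *m cB) ord0 ord0 + (level_tail mu 0%N *m cA) ord0 ord0.
Proof.
move=> sm ecB ecA.
pose g j x := if (0 < lvl x)%N && (ph x == j) then mu x else 0.
pose h x := if (lvl x < 1)%N then mu x * c x else 0.
have sg j : rsummable (g j).
  apply: (rsummable_le _ (rsummable_norm sm)) => x.
  by rewrite /g; case: ifP; rewrite ?normr0.
have [|sh eh] := @rsum_levels _ _ _ 1 h; first by move=> x x0; rewrite /h ltnNge x0.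
have -> : (fun x => mu x * c x) = (fun x => h x + \sum_(j < M1) g j x * cA j ord0).
  apply/funext => x; rewrite /h /g; case: x => -[|k] i.
    by rewrite big1 ?addr0// => j _; rewrite mul0r.
  rewrite add0r (bigD1 i)//= eqxx big1 ?addr0; first by congr (_ * _); exact: ecA.
  move=> j /eqP ji; rewrite /ph/=; case: eqP => [/val_inj e|_]; last by rewrite mul0r.
  by case: ji.
rewrite rsumD//; last by apply: rsummable_sum => j; exact: rsummableZr.
rewrite rsum_sum; last by move=> j; exact: rsummableZr.
congr (_ + _).
  rewrite eh big_nat1 mxE; apply: eq_bigr => j _.
  by rewrite /h /= mxE ecB.
rewrite mxE; apply: eq_bigr => j _; rewrite rsumZr//; congr (_ * _).
rewrite /level_tail /mx_series mxE; apply/esym/cvg_lim => //.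
have := @cvg_phase _ _ _ _ 0 j sm.
suff -> : (fun l => mu (@St M0 M1 (0 + l).+1 j)) =
  (fun l => level_part mu (0 + l).+1 ord0 j) by [].
by apply/funext => l; rewrite mxE.
Qed.

Theorem theorem5p2 (R : realType) (M0 M1 : nat)
    (hM0 : (0 < M0)%N) (hM1 : (0 < M1)%N)
    (X : mg1_blocks R M0 M1)
    (hP : stochastic (mg1_mx X))
    (hPirr : irreducible (mg1_mx X))
    (hA : stochastic (fun i j => sumA X i j))
    (hAirr : irreducible (fun i j => sumA X i j))
    (varpi : 'rV[R]_M1)
    (hvarpi : stationary_distribution (fun i j => sumA X i j)
                (fun i => varpi ord0 i))
    (hmB : forall i, (meanB X i < +oo)%E)
    (hsigma : (drift X varpi < 0)%E)
    (F : nat -> R)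
    (hF : distribution_function F)
    (hFlong : long_tailed F)
    (cA : 'cV[R]_M1) (cB : 'cV[R]_M0)
    (hcA : mx_cvg (fun N => (tailF F N)^-1 *: (tail2A X N *m ones R M1)) cA)
    (hcB : mx_cvg (fun N => (tailF F N)^-1 *: (tail2B X N *m ones R M1)) cB)
    (hcA0 : forall i, 0 <= cA i ord0)
    (hcB0 : forall i, 0 <= cB i ord0)
    (hc : cA <> 0 \/ cB <> 0)
    (pi : mg1_state M0 M1 -> R)
    (hpi : stationary_distribution (mg1_mx X) pi)
    (piN : nat -> mg1_state M0 M1 -> R)
    (hpiN : forall N, (0 < N)%N ->
       stationary_distribution (mg1_mx (LI_trunc X N)) (piN N)) :
  (forall k : nat,
     mx_cvg (fun N => (tailF F N)^-1 *:
                        (level_part (piN N) k - level_part pi k))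
       (decay_const X varpi cA cB pi *: level_part pi k) /\
     (forall i, 0 < (decay_const X varpi cA cB pi *: level_part pi k) ord0 i)) /\
  (forall k : nat,
     (fun N => (tailF F N)^-1 *
        tvnorm (((level_part pi k *m ones R _) ord0 ord0)^-1 *:
                  (level_part (piN N) k - level_part pi k))) @ \oo
       --> decay_const X varpi cA cB pi /\
     0 < decay_const X varpi cA cB pi).
Proof.
have w0 := stationary_gt0 hA hAirr hvarpi.
have mA := meanA_lty hP w0 hsigma.
have hm := row_momentP hP mA hmB.
have [b [B [hb hV]]] := exists_lyap hP w0 hsigma hM1 hm hA hAirr hvarpi.
have s0 := drift_fine_lt0 hP w0 hsigma.
have pi0 := stationary_gt0 hP hPirr hpi.
have [_ spi _] := stationary_prob hpi.
have [F0 Flong] := hFlong.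
have Fcvg : tailF F @ \oo --> (0 : R).
  rewrite -(subrr (1 : R)); case: hF => _ _ F1.
  by apply: cvgB; [exact: cvg_cst|exact: F1].
(* The limits of the normalised overshoots, state by state: they depend on the phase and on whether
   the level is 0. *)
pose c (x : mg1_state M0 M1) : R :=
  match x with
  | existT 0 i => cB i ord0
  | existT k'.+1 i => cA i ord0
  end.
have cc x : (fun n => overshoot X x n.+1 / tailF F n) @ \oo --> c x.
  case: x => -[|k] i.
    have := hcB i ord0; under eq_fun do rewrite mxE (tail2B_overshoot hP i _ hm) mulrC.
    exact.
  have := hcA i ord0; under eq_fun do rewrite mxE (tail2A_overshoot hP k i _ hm) mulrC.
  exact.
have main y := @cvg_LI_trunc _ _ _ X hM0 hP hPirr hm b B _ hb hV s0 pi piN hpi hpiN _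
  F0 Fcvg Flong c cc y.
have ce : rsum (fun x => pi x * c x) / - fine (drift X varpi)
    = decay_const X varpi cA cB pi.
  by rewrite /decay_const (rsum_levels_split (cA := cA) (cB := cB)).
have c0 x : 0 <= c x by case: x => -[|k] i; [exact: hcB0|exact: hcA0].
have [Cc hCc] : exists Cc, forall x, `|c x| <= Cc.
  exists (\sum_i cB i ord0 + \sum_i cA i ord0) => x; rewrite ger0_norm//.
  case: x => -[|k] i /=.
    by rewrite (bigD1 i)//= -addrA lerDl addr_ge0// sumr_ge0.
  by rewrite [X in _ + X](bigD1 i)//= addrCA lerDl addr_ge0// sumr_ge0.
have C0 : 0 < decay_const X varpi cA cB pi.
  rewrite -ce divr_gt0 ?oppr_gt0//.
  (* A positive entry of [cA] is realised on level 1 and one of [cB] on level 0; every state has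
     positive mass under [pi], so a single term makes the constant positive. *)
  have [x cx] : exists x, 0 < c x.
    have nz n (d : 'cV[R]_n) : (forall i, 0 <= d i ord0) -> d <> 0 -> exists i, 0 < d i ord0.
      move=> d0 dn; apply: contrapT => /forallNP h; apply: dn; apply/matrixP => i j.
      rewrite mxE ord1; apply/eqP; rewrite eq_le d0 andbT leNgt; apply/negP/h.
    by case: hc => /nz[//|i hi]; [exists (@St M0 M1 1 i)|exists (@St M0 M1 0 i)].
  apply: (@lt_le_trans _ _ (pi x * c x)); first by rewrite mulr_gt0.
  apply: (rsum_ge1 (f := fun x => pi x * c x)) => [z|].
    by rewrite mulr_ge0// ltW.
  exact: rsummable_prob (stationary_prob hpi) hCc.
split=> k; split=> //.
- move=> i j; rewrite !mxE ord1.
  under eq_fun do rewrite !mxE mulrC.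
  by rewrite -ce; exact: main.
- by move=> i; rewrite !mxE mulr_gt0.
set s := (level_part pi k *m ones R _) ord0 ord0.
have sE : s = \sum_i pi (@St M0 M1 k i).
  by rewrite /s mxE; apply: eq_bigr => i _; rewrite !mxE mulr1.
have lk : (0 < lev M0 M1 k)%N by case: k {s sE} => [|k].
have sgt0 : 0 < s.
  rewrite sE (bigD1 (Ordinal lk))//= ltr_wpDr//; apply: sumr_ge0 => i _; exact: ltW.
have -> : (fun N => (tailF F N)^-1 * tvnorm (s^-1 *: (level_part (piN N) k - level_part pi k)))
  = (fun N => s^-1 * \sum_i `|(piN N (@St M0 M1 k i) - pi (@St M0 M1 k i)) / tailF F N|).
  apply/funext => N; rewrite /tvnorm !mulr_sumr; apply: eq_bigr => i _.
  rewrite !mxE !normrM normfV (gtr0_norm sgt0) normfV (gtr0_norm (F0 N)).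
  by rewrite mulrC -mulrA.
(* The limit vector is a positive multiple of [pi(k)], so its norm divided by [s], the mass of level
   [k], is the factor itself. *)
have -> : decay_const X varpi cA cB pi
    = s^-1 * \sum_i `|decay_const X varpi cA cB pi * pi (@St M0 M1 k i)|.
  under eq_bigr do rewrite (gtr0_norm (mulr_gt0 C0 (pi0 _))).
  by rewrite -mulr_sumr -sE mulrC mulfK ?gt_eqF.
apply: cvgM; first exact: cvg_cst.
apply: cvg_big => [|i _]; first exact: add_continuous.
by apply: cvg_norm; rewrite -ce; exact: main.
Qed.
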